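(* Let $d\ge6$. Then there exists a degree $d$ surface in $\mathbb{P}^3$ belonging to $\left(\overline{F(2,2;3)}\setminus F(2,2;3)\right)\cap F(1,3;3)\cap F(1,1;3)$.
   Context: Work over $\mathbb{C}$. For positive integers $i_1,\dots,i_k<d$, $F(i_1,\dots,i_k;n)\subseteq|\mathcal{O}_{\mathbb{P}^n}(d)|$ is the set of degree $d$ hypersurfaces $\{f=0\}$ of $\mathbb{P}^n$ whose equation can be written $f=\sum_{h=1}^k f_hg_h$ with $f_h,g_h$ homogeneous, $\deg f_h=i_h$, $\deg g_h=d-i_h$, and $f_1,\dots,f_k$ a regular sequence (i.e. $\{f_1=\cdots=f_k=0\}$ is a complete intersection of dimension $n-k$). $\overline{F(i_1,\dots,i_k;n)}$ denotes the Zariski closure in $|\mathcal{O}_{\mathbb{P}^n}(d)|$. *)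

(* Defs.v *)
From HB Require Import structures.
From mathcomp Require Import all_boot all_order all_algebra.
From mathcomp Require Import complex.
From mathcomp Require Import Rstruct.
From mathcomp Require Import mpoly.

Set Implicit Arguments.
Unset Strict Implicit.
Unset Printing Implicit Defensive.

Import Order.TTheory GRing.Theory Num.Theory.
Local Open Scope ring_scope.

Definition CC : Type := complex Rdefinitions.R.

(* Homogeneous coordinate ring of P^n : C[x_0, ..., x_n]. *)
Notation S n := {mpoly CC[n.+1]}.

Definition in_ideal (k : nat) (fs : seq {mpoly CC[k]}) (g : {mpoly CC[k]}) : Prop :=
  exists cs : seq {mpoly CC[k]},
    size cs = size fs /\ g = \sum_(i < size fs) cs`_i * fs`_i.

Definition regular_seq (k : nat) (fs : seq {mpoly CC[k]}) : Prop :=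
  (forall i : nat, (i < size fs)%N ->
     forall g : {mpoly CC[k]},
       in_ideal (take i fs) (fs`_i * g) -> in_ideal (take i fs) g)
  /\ ~ in_ideal fs 1.

(* A degree d hypersurface of P^n is given by a nonzero form of degree d
   (up to scalars; all predicates below are invariant under scaling). *)
Definition hypersurface (n d : nat) (f : S n) : Prop :=
  f != 0 /\ f \is d.-homog.

Definition inF (n d : nat) (degs : seq nat) (f : S n) : Prop :=
  hypersurface d f /\
  exists fs gs : seq (S n),
    [/\ size fs = size degs, size gs = size degs,
        (forall h, (h < size degs)%N ->
            fs`_h \is (nth 0%N degs h).-homog /\ gs`_h \is (d - nth 0%N degs h)%N.-homog),
        f = \sum_(h < size degs) fs`_h * gs`_h
      & regular_seq fs].

(* Zariski closure in |O(d)|: [f] lies in the closure of the set X of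
   hypersurfaces iff every polynomial function in finitely many coefficients
   vanishing on (all representatives in) X vanishes at f. *)
Definition zariski_closure (n d : nat) (X : S n -> Prop) (f : S n) : Prop :=
  hypersurface d f /\
  forall (N : nat) (ms : N.-tuple 'X_{1.. n.+1}) (P : {mpoly CC[N]}),
    (forall g : S n, X g -> P.@[fun i => g@_(tnth ms i)] = 0) ->
    P.@[fun i => f@_(tnth ms i)] = 0.

Arguments inF n d degs f : clear implicits.
Arguments zariski_closure n d X f : clear implicits.

(* Main.v *)
(* Let f = x g with g a general form of degree d - 1 >= 5. Such an f is trivially in
   F(1, k). It is a limit of F(2, 2): write g = x A + y B + b C with b a quadric, and
   use that x b is, up to a factor t, a combination of x^2 and x y + t b.
   Conversely if f is in the ideal of two quadrics q1, q2 without common factor, then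
   g is in the residual ideal (q1, q2) : x, which is the ideal of an elliptic quartic,
   of a conic or of a twisted cubic (possibly degenerate). Counting parameters, forms
   of degree e >= 5 in such ideals satisfy a nontrivial polynomial equation in their
   coefficients: for quartics, for instance, one has a 16-dimensional family of ideals
   of codimension 4 e in degree e. So a general g is in none of them. *)

Require Import Defs.
From HB Require Import structures.
From mathcomp Require Import all_boot all_order all_algebra.
From mathcomp Require Import complex Rstruct mpoly.
From mathcomp Require Import ring.
From mathcomp Require Import zify.
Set Implicit Arguments.
Unset Strict Implicit.
Unset Printing Implicit Defensive.
Import Order.TTheory GRing.Theory Num.Theory.
Local Open Scope ring_scope.

(** * Polynomials vanishing everywhere *)

Section VanishingPolynomials.
Variable F : numFieldType.

(** No dimension theory is used. A family of forms is negligible when its coefficients satisfy one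
    nonzero equation, and this holds for any polynomial image of fewer parameters than there are
    coefficients. For an ideal family, the parameters are the coefficients of the generators plus
    the rank of the degree [e] part of the ideal, which Koszul relations bound from above. The
    inequalities needed are [19 < 4 * e] (quartics), [9 < 2 * e + 1] (conics) and [15 < 3 * e + 1]
    (cubics). The first and the last are tight at [e = 5]: this is where [6 <= d] enters, and why
    generators must be normalised before counting. The residual ideals are found without geometry.
    Over an algebraically closed field the pencil of conics cut on the plane [x = 0] has a singular
    member, so one generator may be taken of the form [l * m + x * n]. The case depends on whether
    the other one vanishes on the line [x = l = 0] or [x = m = 0]. Quotients by these lines are
    realised by substitutions, hence are domains, and [g] is obtained by cancelling in them. *)

Lemma poly_eq0_horner (p : {poly F}) : (forall x, p.[x] = 0) -> p = 0.
Proof.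
move=> p0; apply/eqP/contraT => nz_p.
have := max_poly_roots nz_p (rs := [seq i%:R | i <- iota 0 (size p)]).
rewrite size_map size_iota ltnn; apply.
  by apply/allP => x _; apply/rootP.
by rewrite map_inj_uniq ?iota_uniq //; apply: mulrIn; rewrite oner_eq0.
Qed.

Local Notation widen := (widen_ord (leqnSn _)).

Lemma mcoeff_muni n (p : {mpoly F[n.+1]}) (M : 'X_{1..n.+1}) :
  (muni p)`_(M ord_max)@_[multinom M (widen i) | i < n] = p@_M.
Proof.
rewrite muniE coef_sum raddf_sum /= {3}[p]mpolyE raddf_sum /=.
apply: eq_bigr => m _; rewrite coefZ coefXn mcoeffZ mcoeffX.
case: (m =P M) => [->|neq_mM].
  by rewrite eqxx mulr1 mcoeffZ mcoeffX eqxx mulr1.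
case: eqP => [eq_max|_]; last by rewrite mulr0 mcoeff0 mulr0.
rewrite mulr1 mcoeffZ mcoeffX; case: eqP => // /mnmP eq_w.
case: neq_mM; apply/mnmP => i; have := eq_w; case: (unliftP ord_max i) => [j|] -> //.
by move=> /(_ j); rewrite !mnmE; congr (m _ = M _); apply/val_inj; rewrite /= /bump leqNgt ltn_ord.
Qed.

(** Induction on the number of variables: [muni] turns [p] into a polynomial in the last one, and
    its coefficients are tested at every point [w] of the others. *)
Lemma mpoly_eq0_meval n (p : {mpoly F[n]}) : (forall v, p.@[v] = 0) -> p = 0.
Proof.
elim: n p => [|n IHn] p p0.
  by rewrite -[p]mpolyKC; have := p0 (fun=> 0); rewrite -{1}[p]mpolyKC mevalC => ->.
suff coef0 k : (muni p)`_k = 0.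
  by apply/mpolyP => M; rewrite -mcoeff_muni coef0 !mcoeff0.
apply: IHn => w; have -> : ((muni p)`_k).@[w] = (map_poly (meval w) (muni p))`_k.
  by rewrite coef_map.
rewrite [map_poly _ _]poly_eq0_horner ?coef0 // => t.
pose v i := if unlift ord_max i is Some j then w j else t.
rewrite -[RHS](p0 v) muniE mevalE rmorph_sum horner_sum; apply: eq_bigr => m _.
rewrite /= map_polyZ hornerZ map_polyXn hornerXn /= mevalZ mevalX -mulrA; congr (_ * _).
rewrite big_ord_recr /= {2}/v unlift_none; congr (_ * _); apply: eq_bigr => i _.
rewrite mnmE /v; have -> : widen i = lift ord_max i; last by rewrite liftK.
by apply/val_inj; rewrite /= /bump leqNgt ltn_ord.
Qed.

End VanishingPolynomials.

(** * Sets of forms defined by a nontrivial equation *)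

Section Thin.
Variable F : numFieldType.

(** Lying in a hypersurface stands for having smaller dimension: it is stable under finite unions
    and excludes the whole space. *)
Definition thin M (X : 'rV[F]_M -> Prop) : Prop :=
  exists2 P : {mpoly F[M]}, P != 0 & forall v, X v -> P.@[v 0] = 0.

Lemma thin_sub M (X Y : 'rV[F]_M -> Prop) :
  (forall v, X v -> Y v) -> thin Y -> thin X.
Proof. by move=> sXY [P nzP PY]; exists P => // v /sXY/PY. Qed.

Lemma thin_exists M (I : finType) (X : I -> 'rV[F]_M -> Prop) :
  (forall i, thin (X i)) -> thin (fun v => exists i, X i v).
Proof.
move=> thinX.
have /fin_all_exists[P Pprop] i : exists P : {mpoly F[M]},
  P != 0 /\ forall v, X i v -> P.@[v 0] = 0 by have [P] := thinX i; exists P.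
exists (\prod_i P i); first by apply/prodf_neq0 => i _; case: (Pprop i).
move=> v [i Xiv]; rewrite (bigD1 i) //= mevalM.
by have [_ ->] := Pprop i; rewrite ?mul0r.
Qed.

Lemma thinU M (X Y : 'rV[F]_M -> Prop) :
  thin X -> thin Y -> thin (fun v => X v \/ Y v).
Proof.
move=> [P nzP PX] [Q nzQ QY]; exists (P * Q); first by rewrite mulf_neq0.
by move=> v [/PX|/QY]; rewrite mevalM => ->; rewrite ?mul0r ?mulr0.
Qed.

Lemma thin_proper M (X : 'rV[F]_M -> Prop) : thin X -> exists v, ~ X v.
Proof.
move=> [P /eqP nzP PX]; apply: Classical_Prop.NNPP => allX; apply: nzP.
apply: mpoly_eq0_meval => v; rewrite -(PX (\row_i v i)).
  by apply: meval_eq => i; rewrite mxE.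
by apply: Classical_Prop.NNPP => nXv; apply: allX; exists (\row_i v i).
Qed.

Lemma card_bmultinom_le n b : (#|{: 'X_{1..n < b}}| <= b ^ n)%N.
Proof.
have lt_b (m : 'X_{1..n < b}) i : (m i < b)%N.
  apply: leq_ltn_trans (bmdeg m); by rewrite mdegE (bigD1 i) //= leq_addr.
pose f (m : 'X_{1..n < b}) : {ffun 'I_n -> 'I_b} := [ffun i => Ordinal (lt_b m i)].
have -> : (b ^ n = #|{: {ffun 'I_n -> 'I_b}}|)%N by rewrite card_ffun !card_ord.
apply: (leq_card f) => m1 m2 eq_f.
apply/val_inj/mnmP => i; have := congr1 (fun g : {ffun _ -> _} => val (g i)) eq_f.
by rewrite !ffunE.
Qed.

Lemma msizeM_leS n (p q : {mpoly F[n]}) a b :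
  (msize p <= a.+1 -> msize q <= b.+1 -> msize (p * q) <= (a + b).+1)%N.
Proof.
have [->|nz_p] := eqVneq p 0; first by rewrite mul0r mmeasure0.
have [->|nz_q] := eqVneq q 0; first by rewrite mulr0 mmeasure0.
by rewrite msizeM //; move: (msize p) (msize q) => s t; lia.
Qed.

(** By counting: the [k ^ M] products of powers of the [phi i] with exponents below [k] have degree
    below [B], which is linear in [k], hence lie in a space of dimension at most [B ^ n]. For large
    [k] they are linearly dependent, and a relation is the equation [P]. *)
Lemma algebraic_dependence n M (phi : 'I_M -> {mpoly F[n]}) : (n < M)%N ->
  exists2 P : {mpoly F[M]}, P != 0 & forall t, P.@[fun i => (phi i).@[t]] = 0.
Proof.
move=> lt_nM; pose D := \max_i msize (phi i).
(* Chosen so that [B <= c * k] and [c ^ n < k], whence [B ^ n <= c ^ n * k ^ n < k ^ n.+1 <= k ^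
   M]. *)
pose c := (M * D).+1; pose k := (c ^ n).+1; pose B := (M * D * k).+1.
pose Phi (e : {ffun 'I_M -> 'I_k}) : {mpoly F[n]} := \prod_i phi i ^+ e i.
have Phi_coef e (m : 'X_{1..n}) : (B <= mdeg m)%N -> (Phi e)@_m = 0.
  move=> le_Bm; apply: memN_msupp_eq0; apply: msize_mdeg_ge; apply: leq_trans le_Bm.
  suff le_phi i : (msize (phi i ^+ e i) <= (D * k).+1)%N.
    rewrite /Phi /B -mulnA; rewrite -[X in (X * (D * k))%N]card_ord -sum_nat_const.
    elim/big_rec2: _ => [|i a p _ IHp]; first by rewrite mmeasure1.
    exact: msizeM_leS.
  have le_expr l : (msize (phi i ^+ l) <= (D * l).+1)%N.
    elim: l => [|l IHl]; first by rewrite expr0 mmeasure1.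
    rewrite exprS mulnS; apply: msizeM_leS => //.
    exact: leq_trans (leq_bigmax i) (leqnSn _).
  apply: leq_trans (le_expr _) _.
  by rewrite ltnS leq_mul2l (ltnW (ltn_ord _)) orbT.
pose A := \matrix_(i < #|{: {ffun 'I_M -> 'I_k}}|, j < #|{: 'X_{1..n < B}}|)
  (Phi (enum_val i))@_(enum_val j).
have lt_card : (#|{: 'X_{1..n < B}}| < #|{: {ffun 'I_M -> 'I_k}}|)%N.
  apply: leq_ltn_trans (card_bmultinom_le _ _) _.
  rewrite card_ffun !card_ord.
  apply: (@leq_ltn_trans ((c * k) ^ n)).
    have [->|n_gt0] := posnP n; first by rewrite !expn0.
    by rewrite leq_exp2r // /B /c mulSn addnC -addn1 leq_add2l.
  rewrite expnMn; apply: (@leq_trans (k * k ^ n)).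
    by rewrite ltn_mul2r expn_gt0 /= ltnSn.
  by rewrite -expnS leq_pexp2l.
have /rowV0Pn[u /sub_kermxP uA nz_u] : kermx A != 0.
  by rewrite kermx_eq0 -row_leq_rank -ltnNge (leq_ltn_trans (rank_leq_col _)).
pose mono (e : {ffun 'I_M -> 'I_k}) := [multinom e i : nat | i < M].
have mono_inj : injective mono.
  move=> e1 e2 /mnmP eq_e; apply/ffunP => i; apply/val_inj.
  by have := eq_e i; rewrite !mnmE.
exists (\sum_i u 0 i *: 'X_[mono (enum_val i)]).
  apply: contraNneq nz_u => /mpolyP P0; apply/eqP/rowP => i; rewrite mxE.
  have := P0 (mono (enum_val i)); rewrite mcoeff0 raddf_sum /= (bigD1 i) //=.
  rewrite mcoeffZ mcoeffX eqxx mulr1 big1 ?addr0 // => j neq_ji.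
  by rewrite mcoeffZ mcoeffX (inj_eq mono_inj) (inj_eq enum_val_inj) (negPf neq_ji) mulr0.
have sum0 : \sum_i u 0 i *: Phi (enum_val i) = 0.
  apply/mpolyP => m; rewrite mcoeff0 raddf_sum /=.
  have [lt_mB|le_Bm] := ltnP (mdeg m) B; last first.
    by apply: big1 => i _; rewrite mcoeffZ Phi_coef // mulr0.
  have := congr1 (fun r : 'rV_ _ => r 0 (enum_rank (BMultinom lt_mB))) uA.
  rewrite !mxE => {2}<-; apply: eq_bigr => i _.
  by rewrite mcoeffZ mxE enum_rankK.
move=> t; rewrite -[RHS](meval0 t) -sum0 !rmorph_sum /=; apply: eq_bigr => i _.
rewrite !mevalZ mevalX rmorph_prod /=; congr (_ * _); apply: eq_bigr => j _.
by rewrite mnmE rmorphXn.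
Qed.

Lemma thin_image n M (phi : 'I_M -> {mpoly F[n]}) : (n < M)%N ->
  thin (fun v => exists t, v = \row_i (phi i).@[t]).
Proof.
move=> /(algebraic_dependence phi)[P nzP Pphi]; exists P => // v [t ->].
by rewrite -[RHS](Pphi t); apply: meval_eq => i; rewrite mxE.
Qed.

(* The parameters outside [Z] and the coordinates in a basis of the row space,
   extracted among the rows of [A], give fewer than [M] free parameters. *)
Lemma thin_rowspace (I : finType) K M r (A : 'M[{mpoly F[#|I|]}]_(K, M))
    (Z : {set I}) (z : I -> F) :
  (#|~: Z| + r < M)%N ->
  thin (fun v => exists c : I -> F, let Ac := map_mx (meval (c \o enum_val)) A in
    [/\ {in Z, c =1 z}, (\rank Ac <= r)%N & (v <= Ac)%MS]).
Proof.
move=> lt_M; pose J k := ({i | i \in ~: Z} + 'I_k)%type.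
have cardJ (k : 'I_r.+1) : (#|{: J k}| < M)%N.
  rewrite card_sum card_ord card_sig; apply: leq_ltn_trans lt_M.
  by rewrite leq_add2l -ltnS.
pose sub k (i : 'I_#|I|) : {mpoly F[#|{: J k}|]} :=
  if insub (enum_val i) is Some j then 'X_(enum_rank (inl j : J k))
  else (z (enum_val i))%:MP.
pose phi k (f : {ffun 'I_k -> 'I_K}) (m : 'I_M) : {mpoly F[#|{: J k}|]} :=
  \sum_(j < k) 'X_(enum_rank (inr j : J k)) * (A (f j) m \mPo [tuple sub k i | i < #|I|]).
(* The rank of [Ac] and the rows forming a basis depend on [c], but the choices are finitely many
   and each yields the image of a polynomial map. *)
apply: thin_sub (thin_exists (fun k : 'I_r.+1 =>
  thin_exists (fun f => thin_image (phi k f) (cardJ k)))) => v [c] /=.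
set Ac := map_mx _ A => -[cz rk_le sub_v]; have lt_rk : (\rank Ac < r.+1)%N by [].
exists (Ordinal lt_rk); exists [ffun j => maxrankfun Ac j].
have: (v <= rowsub (maxrankfun Ac) Ac)%MS by rewrite eq_maxrowsub.
case/submxP => u ->.
exists (fun k => match enum_val k with inl i => c (val i) | inr j => u 0 j end).
apply/rowP => m; rewrite !mxE rmorph_sum /=; apply: eq_bigr => j _.
rewrite mevalM mevalXU enum_rankK; congr (_ * _).
rewrite comp_mpoly_meval !mxE ffunE; apply: meval_eq => i /=.
rewrite tnth_mktuple /sub; case: insubP => [l _ <-|].
  by rewrite mevalXU enum_rankK.
by rewrite inE negbK mevalC => /cz.
Qed.

End Thin.

(** * Multiplication matrices *)

Section Forms.
Variable n : nat.

Definition hdim d := 'C(d + n, d).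

Definition mon d (i : 'I_(hdim d)) : 'X_{1..n.+1} :=
  nth 0%MM [seq s2m t | t : d.-tuple 'I_n.+1 <- enum (basis n.+1 d)] i.

Lemma mdeg_mon d (i : 'I_(hdim d)) : mdeg (mon i) = d.
Proof. by apply/eqP; rewrite basis_cover mem_nth // size_basis. Qed.

Lemma mon_inj d : injective (@mon d).
Proof.
move=> i j /eqP; rewrite nth_uniq ?size_basis ?uniq_basis // => /eqP.
exact: val_inj.
Qed.

Lemma mon_surj d m : mdeg m = d -> exists i : 'I_(hdim d), m = mon i.
Proof.
move=> /eqP; rewrite basis_cover => /(nthP 0%MM)[i lt_i <-].
by rewrite size_basis in lt_i; exists (Ordinal lt_i).
Qed.

Section Ring.
Variable R : comNzRingType.
Implicit Types p q : {mpoly R[n.+1]}.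

Definition coefrow d p : 'rV[R]_(hdim d) := \row_i p@_(mon i).

Definition form_of d (v : 'rV[R]_(hdim d)) := \sum_i v 0 i *: 'X_[mon i].

Lemma form_of_homog d (v : 'rV[R]_(hdim d)) : form_of v \is d.-homog.
Proof.
apply: rpred_sum => i _; rewrite rpredZ // dhomogX; apply/eqP/mdeg_mon.
Qed.

Lemma coefrow_form d (v : 'rV[R]_(hdim d)) : coefrow d (form_of v) = v.
Proof.
apply/rowP => i; rewrite mxE raddf_sum /= (bigD1 i) //= mcoeffZ mcoeffX eqxx.
rewrite mulr1 big1 ?addr0 // => j neq_ji.
by rewrite mcoeffZ mcoeffX (inj_eq (@mon_inj d)) (negPf neq_ji) mulr0.
Qed.

Lemma coefrow_inj d p q : p \is d.-homog -> q \is d.-homog ->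
  coefrow d p = coefrow d q -> p = q.
Proof.
move=> hp hq eq_pq; apply/mpolyP => m.
have [/mon_surj[i ->]|/eqP neq_d] := mdeg m =P d.
  by have /rowP/(_ i) := eq_pq; rewrite !mxE.
by rewrite (dhomog_nemf_coeff hp) // (dhomog_nemf_coeff hq).
Qed.

Lemma coefrowK d p : p \is d.-homog -> form_of (coefrow d p) = p.
Proof.
by move=> hp; apply: (coefrow_inj (form_of_homog _) hp); rewrite coefrow_form.
Qed.

Lemma coefrow0 d : coefrow d 0 = 0.
Proof. by apply/rowP => i; rewrite !mxE mcoeff0. Qed.

Lemma coefrowD d : {morph coefrow d : p q / p + q}.
Proof. by move=> p q; apply/rowP => i; rewrite !mxE mcoeffD. Qed.

Lemma coefrowZ d c p : coefrow d (c *: p) = c *: coefrow d p.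
Proof. by apply/rowP => i; rewrite !mxE mcoeffZ. Qed.

Definition mulmat d e q : 'M[R]_(hdim d, hdim e) :=
  \matrix_(i, j) (q * 'X_[mon i])@_(mon j).

Lemma row_mulmat d e q i : row i (mulmat d e q) = coefrow e (q * 'X_[mon i]).
Proof. by apply/rowP => j; rewrite !mxE. Qed.

(** As [q] is homogeneous, only the degree [d] part of [a] reaches degree [e] in [q * a]; arbitrary
    cofactors of an ideal member are thus handled by linear algebra. *)
Lemma coefrowM s d e q a : q \is s.-homog -> e = (s + d)%N ->
  coefrow e (q * a) = coefrow d a *m mulmat d e q.
Proof.
move=> hq def_e; elim/mpolyind: a => [|c m p _ _ IHp].
  by rewrite mulr0 !coefrow0 mul0mx.
rewrite mulrDr -scalerAr !coefrowD !coefrowZ mulmxDl IHp -scalemxAl.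
congr (_ *: _ + _).
have [/mon_surj[i ->]|/eqP neq_d] := mdeg m =P d.
  rewrite -row_mulmat rowE; congr (_ *m _).
  by apply/rowP => j; rewrite !mxE mcoeffX (inj_eq (@mon_inj d)) eq_sym eqxx.
have -> : coefrow d 'X_[m] = 0.
  apply/rowP => j; rewrite !mxE mcoeffX; case: eqP => // def_m.
  by rewrite def_m mdeg_mon eqxx in neq_d.
rewrite mul0mx; apply/rowP => j; rewrite !mxE.
have hqm : q * 'X_[m] \is (s + mdeg m).-homog by rewrite dhomogM // dhomogX.
by rewrite (dhomog_nemf_coeff hqm) //= mdeg_mon def_e eqn_add2l eq_sym.
Qed.

Lemma mulmatM s d d' e q r : q \is s.-homog -> e = (s + d')%N ->
  mulmat d d' r *m mulmat d' e q = mulmat d e (q * r).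
Proof.
move=> hq def_e; apply/row_matrixP => i.
by rewrite row_mul !row_mulmat -mulrA (coefrowM _ hq def_e).
Qed.

End Ring.

Lemma mulmat_map (R S : comNzRingType) (f : {rmorphism R -> S}) d e q :
  map_mx f (mulmat d e q) = mulmat d e (map_mpoly f q).
Proof.
apply/matrixP => i j; rewrite !mxE -mcoeff_map_mpoly rmorphM /=.
by rewrite map_mpolyX.
Qed.

Section Rank.
Variable F : fieldType.
Implicit Types p q : {mpoly F[n.+1]}.

Lemma mulmat_free s d e q : q \is s.-homog -> e = (s + d)%N -> q != 0 ->
  row_free (mulmat d e q).
Proof.
move=> hq def_e nz_q; rewrite -kermx_eq0; apply/rowV0P => u /sub_kermxP uq0.
suff /eqP : q * form_of u = 0.
  rewrite mulf_eq0 (negPf nz_q) /= => /eqP u0.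
  by rewrite -[u]coefrow_form u0 coefrow0.
apply: (@coefrow_inj _ e) (dhomog0 _ _ _) _.
  by rewrite def_e dhomogM // form_of_homog.
by rewrite (coefrowM _ hq def_e) coefrow_form uq0 coefrow0.
Qed.

(* The Koszul relations [q1 * q2 = q2 * q1] lower the rank. *)
Lemma koszul_rank s1 s2 d e q1 q2 :
  q1 \is s1.-homog -> q2 \is s2.-homog -> q1 != 0 ->
  e = (s1 + s2 + d)%N ->
  (\rank (col_mx (mulmat (s2 + d) e q1) (mulmat (s1 + d) e q2)) + hdim d
     <= hdim (s2 + d) + hdim (s1 + d))%N.
Proof.
move=> h1 h2 nz_q1 def_e.
have e1 : e = (s1 + (s2 + d))%N by rewrite addnA.
have e2 : e = (s2 + (s1 + d))%N by rewrite addnCA addnA.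
(* The rows of [B] are the Koszul syzygies; they are independent since multiplication by [q1] is
   injective. *)
pose B := row_mx (mulmat d (s2 + d) q2) (- mulmat d (s1 + d) q1).
have <- : \rank B = hdim d.
  apply/eqP; change (row_free B); rewrite -kermx_eq0; apply/rowV0P => u.
  move/sub_kermxP; rewrite mul_mx_row -[0]row_mx0 => /eq_row_mx[_ /eqP].
  rewrite mulmxN oppr_eq0 mulmx_free_eq0 ?(mulmat_free h1) // => /eqP //.
rewrite addnC; apply: mulmx0_rank_max; rewrite mul_row_col mulNmx.
by rewrite (mulmatM _ _ h1 e1) (mulmatM _ _ h2 e2) [q2 * q1]mulrC subrr.
Qed.

End Rank.
End Forms.

(** * Elimination of a variable by a linear form *)

Section Elimination.
Variables (n : nat) (F : fieldType).
Implicit Types (p q l : {mpoly F[n]}) (i j : 'I_n).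

Lemma homog1E l : l \is 1.-homog -> l = \sum_i l@_U_(i) *: 'X_i.
Proof.
move=> hl; apply/mpolyP => m; rewrite raddf_sum /=.
have [/eqP/mdeg1P[i /eqP ->]|/eqP neq_m] := mdeg m =P 1%N.
  rewrite (bigD1 i) //= mcoeffZ mcoeffXU eqxx mulr1 big1 ?addr0 // => j neq_ji.
  by rewrite mcoeffZ mcoeffXU (negPf neq_ji) mulr0.
rewrite (dhomog_nemf_coeff hl) // big1 // => i _; rewrite mcoeffZ mcoeffX.
case: eqP => [def_m|_]; last by rewrite mulr0.
by rewrite -def_m mdeg1 in neq_m.
Qed.

Lemma homog1_neq0 l : l \is 1.-homog -> l != 0 -> exists i, l@_U_(i) != 0.
Proof.
move=> hl; case: (pickP (fun i => l@_U_(i) != 0)) => [i|l0]; first by exists i.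
case/negP; rewrite [l]homog1E // big1 // => i _.
by have /negbFE/eqP -> := l0 i; rewrite scale0r.
Qed.

Lemma mpolyX_homog i : ('X_i : {mpoly F[n]}) \is 1.-homog.
Proof. by rewrite dhomogX /= mdeg1. Qed.

Lemma comp_mpoly_homog k d p (s : n.-tuple {mpoly F[k]}) :
  (forall i, tnth s i \is 1.-homog) -> p \is d.-homog -> p \mPo s \is d.-homog.
Proof.
move=> hs /dhomogP hp; rewrite comp_mpolyEX big_seq; apply: rpred_sum => m /hp <-.
rewrite rpredZ // comp_mpolyX /= mdegE.
elim/big_rec2: _ => [|i d1 p1 _ IH]; first exact: dhomog1.
apply: dhomogM => //; have := dhomogMn (m i) (hs i); by rewrite mul1n.
Qed.

(** When ['X_i] occurs in [l], this substitutes for it the solution of [l = 0], a linear form in the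
    other variables. *)
Definition elim i l : n.-tuple {mpoly F[n]} :=
  [tuple 'X_j - (if j == i then (l@_U_(i))^-1 *: l else 0) | j < n].

Lemma elimX i l j :
  'X_j \mPo elim i l = 'X_j - (if j == i then (l@_U_(i))^-1 *: l else 0).
Proof. by rewrite comp_mpolyXU -tnth_nth tnth_mktuple. Qed.

Lemma elim_homog i l d p : l \is 1.-homog -> p \is d.-homog ->
  p \mPo elim i l \is d.-homog.
Proof.
move=> hl; apply: comp_mpoly_homog => j; rewrite tnth_mktuple rpredB ?mpolyX_homog //.
by case: eqP; rewrite ?rpred0 // rpredZ.
Qed.

Lemma elim_mod i l p : exists c, p = p \mPo elim i l + l * c.
Proof.
elim/mpolyind: p => [|a m p _ _ [c IHp]].
  by exists 0; rewrite comp_mpoly0 mulr0 addr0.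
have [c' def_m] : exists c', 'X_[m] = 'X_[m] \mPo elim i l + l * c'.
  rewrite mpolyXE_id rmorph_prod /=; elim/big_rec2: _ => [|j x y _ [d ->]].
    by exists 0; rewrite mulr0 addr0.
  have [b def_Xm] : exists b, 'X_j ^+ m j = ('X_j ^+ m j) \mPo elim i l + l * b.
    rewrite rmorphXn /=; elim: (m j) => [|k [b IHk]].
      by exists 0; rewrite !expr0 mulr0 addr0.
    have [b' def_X] : exists b', 'X_j = 'X_j \mPo elim i l + l * b'.
      rewrite elimX; exists (if j == i then ((l@_U_(i))^-1)%:MP else 0).
      by case: eqP => _; rewrite ?mulr0 ?subr0 ?addr0 // mulrC mul_mpolyC subrK.
    exists (b' * 'X_j ^+ k + ('X_j \mPo elim i l) * b).
    by rewrite !exprS {1}def_X mulrDl {1}IHk; ring.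
  rewrite {1}def_Xm; move: ('X_j ^+ m j \mPo _) => Z.
  by exists (b * x + Z * d + b * l * d); ring.
exists (a *: c' + c); rewrite {1}IHp {1}def_m comp_mpolyD comp_mpolyZ -!mul_mpolyC.
ring.
Qed.

Lemma elim_self i l : l \is 1.-homog -> l@_U_(i) != 0 -> l \mPo elim i l = 0.
Proof.
move=> hl nz_li; rewrite [X in X \mPo _]homog1E // rmorph_sum /= (bigD1 i) //=.
rewrite comp_mpolyZ elimX eqxx scalerBr scalerA divff // scale1r.
rewrite (eq_bigr (fun j => l@_U_(j) *: 'X_j)) => [|j neq_ji]; last first.
  by rewrite comp_mpolyZ elimX (negPf neq_ji) subr0.
by rewrite addrAC; move: (homog1E hl); rewrite (bigD1 i) //= => <-; rewrite subrr.
Qed.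

(* Elimination of a variable realizes the quotient by a linear form as a
   polynomial ring; in particular linear forms are prime. *)
Lemma elim_dvd i l p : l \is 1.-homog -> l@_U_(i) != 0 ->
  (exists c, p = l * c) <-> p \mPo elim i l = 0.
Proof.
move=> hl nz_li; split=> [[c ->]|p0]; first by rewrite rmorphM /= elim_self // mul0r.
by have [c ->] := elim_mod i l p; exists c; rewrite p0 add0r.
Qed.

(** [elim i 'X_i] is the substitution of 0 for ['X_i]. *)
Definition var_free i p := p \mPo elim i 'X_i = p.

Lemma var_freeX i j : j != i -> var_free i 'X_j.
Proof. by move=> neq_ji; rewrite /var_free elimX (negPf neq_ji) subr0. Qed.

Lemma elimXX i : ('X_i : {mpoly F[n]}) \mPo elim i 'X_i = 0.
Proof. by rewrite elimX eqxx mcoeffXU eqxx invr1 scale1r subrr. Qed.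

Lemma elim_idem i p : var_free i (p \mPo elim i 'X_i).
Proof.
have [c def_p] := elim_mod i 'X_i p.
by rewrite /var_free {2}def_p rmorphD rmorphM /= elimXX mul0r addr0.
Qed.

Lemma var_freeP i p (m : 'X_{1..n}) : var_free i p -> m i != 0%N -> p@_m = 0.
Proof.
move=> <- nz_mi; rewrite comp_mpolyEX raddf_sum /= big1 // => m' _.
rewrite mcoeffZ comp_mpolyX; have [m'i0|m'i0] := eqVneq (m' i) 0%N; last first.
  rewrite (bigD1 i) //= tnth_mktuple eqxx mcoeffXU eqxx invr1 scale1r subrr.
  by rewrite expr0n (negPf m'i0) mul0r mcoeff0 mulr0.
have -> : \prod_j tnth (elim i 'X_i) j ^+ m' j = 'X_[F, m'].
  rewrite [RHS]mpolyXE_id; apply: eq_bigr => j _; rewrite tnth_mktuple.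
  by case: eqP => [->|_]; rewrite ?subr0 // m'i0 !expr0.
rewrite mcoeffX; case: eqP => [def_m|_]; last by rewrite mulr0.
by rewrite -def_m m'i0 in nz_mi.
Qed.

Lemma comp_mpolyA k r (s : n.-tuple {mpoly F[k]}) (t : k.-tuple {mpoly F[r]}) p :
  (p \mPo s) \mPo t = p \mPo [tuple tnth s j \mPo t | j < n].
Proof.
rewrite [p \mPo s]comp_mpolyEX [RHS]comp_mpolyEX rmorph_sum /=; apply: eq_bigr => m _.
rewrite comp_mpolyZ !comp_mpolyX rmorph_prod /=; congr (_ *: _).
by apply: eq_bigr => j _; rewrite rmorphXn tnth_mktuple.
Qed.

Lemma elim_var_free_other i k l p : var_free k l -> k != i ->
  var_free k p -> var_free k (p \mPo elim i l).
Proof.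
move=> kl neq_ki kp; rewrite /var_free.
transitivity ((p \mPo elim k 'X_k) \mPo elim i l); last by rewrite [p \mPo _]kp.
rewrite [LHS]comp_mpolyA [RHS]comp_mpolyA.
apply: (congr1 (fun s => comp_mpoly s p)).
apply: eq_from_tnth => j; rewrite !tnth_mktuple.
have [->|neq_jk] := eqVneq j k.
  rewrite (negPf neq_ki) subr0 elimXX mcoeffXU eqxx invr1 scale1r subrr.
  by rewrite comp_mpoly0.
rewrite [in RHS]subr0 elimX rmorphB /= var_freeX //; congr (_ - _).
by case: eqP => _; rewrite ?comp_mpoly0 // comp_mpolyZ kl.
Qed.

Lemma elim_var_free i l p : l \is 1.-homog -> l@_U_(i) != 0 ->
  var_free i (p \mPo elim i l).
Proof.
move=> hl nz_li; rewrite /var_free comp_mpolyA; congr comp_mpoly.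
apply: eq_from_tnth => j; rewrite !tnth_mktuple rmorphB /=.
have [->|neq_ji] := eqVneq j i; last by rewrite var_freeX // comp_mpoly0.
set l_i := _^-1.
have -> : (l_i *: l) \mPo elim i 'X_i = l_i *: l - 'X_i.
  rewrite comp_mpolyZ [X in X \mPo _]homog1E // rmorph_sum /= [in RHS](homog1E hl).
  rewrite (bigD1 i) //= comp_mpolyZ elimXX scaler0 add0r.
  rewrite [in RHS](bigD1 i) //= scalerDr scalerA mulVf // scale1r.
  rewrite addrAC subrr add0r; congr (_ *: _).
  by apply: eq_bigr => k neq_ki; rewrite comp_mpolyZ var_freeX.
by rewrite elimXX sub0r opprB.
Qed.

End Elimination.

(** * Parameter counts *)

Section GenericForms.
Variables (F : numFieldType) (I : finType).

(** The coefficients are indeterminates indexed by [I], so that a single matrix over a polynomial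
    ring describes a whole family of ideals and is specialised by evaluation. *)
Definition generic_form n d (t : 'I_(hdim n d) -> I) :
    {mpoly {mpoly F[#|I|]}[n.+1]} :=
  \sum_i 'X_(enum_rank (t i)) *: 'X_[mon i].

Lemma generic_formE n d (t : 'I_(hdim n d) -> I) (c : I -> F) :
  map_mpoly (meval (c \o enum_val)) (generic_form t) = form_of (\row_i c (t i)).
Proof.
rewrite rmorph_sum /=; apply: eq_bigr => i _.
by rewrite map_mpolyZ /= mevalXU /= enum_rankK map_mpolyX mxE.
Qed.

Lemma generic_form_eq n d (t : 'I_(hdim n d) -> I) (c : I -> F) q :
  q \is d.-homog -> (forall i, c (t i) = q@_(mon i)) ->
  map_mpoly (meval (c \o enum_val)) (generic_form t) = q.
Proof.
move=> hq cq; rewrite generic_formE -[RHS](coefrowK hq); congr form_of.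
by apply/rowP => i; rewrite !mxE.
Qed.

Definition generic_linear n (t : 'I_n -> I) : {mpoly {mpoly F[#|I|]}[n]} :=
  \sum_i 'X_(enum_rank (t i)) *: 'X_i.

Lemma generic_linear_eq n (t : 'I_n -> I) (c : I -> F) l :
  l \is 1.-homog -> (forall i, c (t i) = l@_U_(i)) ->
  map_mpoly (meval (c \o enum_val)) (generic_linear t) = l.
Proof.
move=> hl cl; rewrite [RHS](homog1E hl) rmorph_sum /=; apply: eq_bigr => i _.
by rewrite map_mpolyZ /= mevalXU /= enum_rankK map_mpolyX cl.
Qed.

End GenericForms.

Section ThinFamilies.
Variable F : numFieldType.
Implicit Types (a b c q l m : {mpoly F[4]}).

Lemma hdim3 d : (hdim 3 d * 6 = d.+1 * d.+2 * d.+3)%N.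
Proof.
rewrite /hdim -bin_sub ?leq_addr // addKn.
have := bin_ffact (d + 3) 3; rewrite (_ : 3`! = 6)%N // => ->.
by rewrite addnC 3!ffactnS ffactn0; lia.
Qed.

(* Scaling a coefficient of [q1] to 1 leaves 19 parameters, and the ideal of [q1]
   and [q2] has codimension at least [4 * e] in degree [e]. *)
Lemma quartic_thin e : (5 <= e)%N ->
  thin (fun v : 'rV[F]_(hdim 3 e) => exists q1 q2 a b,
    [/\ q1 \is 2.-homog, q2 \is 2.-homog, q1 != 0
      & v = coefrow e (q1 * a + q2 * b)]).
Proof.
move=> le5e.
have [d d_gt0 def_e] : exists2 d, (0 < d)%N & e = (2 + 2 + d)%N.
  by exists (e - 4)%N; lia.
have def_e' : e = (2 + (2 + d))%N by lia.
pose I := ('I_(hdim 3 2) + 'I_(hdim 3 2))%type.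
pose Q1 := generic_form F (inl : _ -> I); pose Q2 := generic_form F (inr : _ -> I).
pose A := col_mx (mulmat (2 + d) e Q1) (mulmat (2 + d) e Q2).
pose r := (hdim 3 (2 + d) + hdim 3 (2 + d) - hdim 3 d)%N.
have cardZ (k : 'I_(hdim 3 2)) : (#|~: [set (inl k : I)]| + r < hdim 3 e)%N.
  rewrite cardsCs setCK cards1 card_sum card_ord.
  have := hdim3 2; have := hdim3 d; have := hdim3 (2 + d); have := hdim3 e.
  rewrite /r def_e; lia.
(* Which coefficient of [q1] can be scaled to 1 depends on [q1], hence a finite union over [k]. *)
apply: thin_sub (thin_exists (fun k => thin_rowspace A (fun=> 1) (cardZ k))).
move=> v [q1 [q2 [a [b [h1 h2 nz_q1 ->]]]]].
have [k nz_k] : exists k : 'I_(hdim 3 2), q1@_(mon k) != 0.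
  case: (pickP (fun k : 'I_(hdim 3 2) => q1@_(mon k) != 0)) => [k|q1_0]; first by exists k.
  case/negP: nz_q1; rewrite -(coefrowK h1) /form_of big1 // => k _.
  by rewrite mxE; have /negbFE/eqP -> := q1_0 k; rewrite scale0r.
pose s := q1@_(mon k); pose q := s^-1 *: q1.
have hq : q \is 2.-homog by rewrite rpredZ.
have nz_q : q != 0 by rewrite scaler_eq0 invr_eq0 negb_or nz_k.
exists k; exists (fun i : I => match i with inl j => q@_(mon j) | inr j => q2@_(mon j) end).
set c := (fun i => _) => Ac.
have def_Ac : Ac = col_mx (mulmat (2 + d) e q) (mulmat (2 + d) e q2).
  rewrite /Ac map_col_mx; congr col_mx; rewrite mulmat_map; congr mulmat.
    exact: generic_form_eq.
  exact: generic_form_eq.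
split=> [i||].
- by rewrite inE => /eqP ->; rewrite /= mcoeffZ mulVf.
- by have := koszul_rank hq h2 nz_q def_e; rewrite -def_Ac /r; lia.
have -> : q1 * a + q2 * b = q * (s *: a) + q2 * b.
  by rewrite -scalerAr scalerAl scalerA divff // scale1r.
apply/submxP; exists (row_mx (coefrow _ (s *: a)) (coefrow _ b)).
rewrite def_Ac mul_row_col coefrowD; congr (_ + _).
  exact: coefrowM hq def_e'.
exact: coefrowM h2 def_e'.
Qed.

(* Eliminating from [q] a variable of [m] leaves 3 + 6 parameters, and the ideal of
   [m] and [q] has codimension at least [2 * e + 1] in degree [e]. *)
Lemma conic_thin e : (5 <= e)%N ->
  thin (fun v : 'rV[F]_(hdim 3 e) => exists m q a b,
    [/\ m \is 1.-homog, q \is 2.-homog, m != 0 & v = coefrow e (m * a + q * b)]).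
Proof.
move=> le5e.
have [d d_gt1 def_e] : exists2 d, (1 < d)%N & e = (1 + 2 + d)%N.
  by exists (e - 3)%N; lia.
have e1 : e = (1 + (2 + d))%N by lia.
have e2 : e = (2 + (1 + d))%N by lia.
pose I := ('I_4 + 'I_(hdim 3 2))%type.
pose L := generic_linear F (inl : _ -> I); pose Q := generic_form F (inr : _ -> I).
pose A := col_mx (mulmat (2 + d) e L) (mulmat (1 + d) e Q).
pose r := (hdim 3 (2 + d) + hdim 3 (1 + d) - hdim 3 d)%N.
pose Z i := [set u : I | match u with inl j => j == i | inr j => mon j i != 0%N end].
pose z (u : I) : F := if u is inl _ then 1 else 0.
have cardZ i : (#|~: Z i| + r < hdim 3 e)%N.
  (* The five are the coefficient of ['X_i] in the linear form and those of the four products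
     ['X_i * 'X_k] in the quadric. *)
  have le5 : (5 <= #|Z i|)%N.
    have /fin_all_exists[j jE] k : exists j : 'I_(hdim 3 2), (U_(i) + U_(k))%MM = mon j.
      by apply: mon_surj; rewrite mdegD !mdeg1.
    pose f k : I := if k is Some k then inr (j k) else inl i.
    have f_inj : injective f.
      move=> [k1|] [k2|] //= [eq_j]; have := jE k1; rewrite eq_j -jE => /addmI/eqP.
      by rewrite eq_mnm1 => /eqP ->.
    have -> : (5 = #|f @: [set: option 'I_4]|)%N.
      by rewrite card_imset // cardsT card_option card_ord.
    apply/subset_leq_card/subsetP => _ /imsetP[[k|] _ ->]; rewrite inE //=.
    by rewrite -jE mnmDE mnm1E eqxx.
  rewrite cardsCs setCK card_sum !card_ord.
  have := hdim3 2; have := hdim3 d; have := hdim3 (2 + d); have := hdim3 (1 + d).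
  have := hdim3 e; rewrite /r def_e; lia.
apply: thin_sub (thin_exists (fun i => thin_rowspace A z (cardZ i))).
move=> v [m [q [a [b [hm hq nz_m ->]]]]].
have [i nz_mi] := homog1_neq0 hm nz_m.
pose s := m@_U_(i); pose m' := s^-1 *: m; pose q' := q \mPo elim i m.
have hm' : m' \is 1.-homog by rewrite rpredZ.
have hq' : q' \is 2.-homog by apply: elim_homog.
have nz_m' : m' != 0 by rewrite scaler_eq0 invr_eq0 negb_or nz_mi.
have [c def_q] := elim_mod i m q.
exists i; exists (fun u : I => match u with inl j => m'@_U_(j) | inr j => q'@_(mon j) end).
set cc := (fun u => _) => Ac.
have def_Ac : Ac = col_mx (mulmat (2 + d) e m') (mulmat (1 + d) e q').
  rewrite /Ac map_col_mx; congr col_mx; rewrite mulmat_map; congr mulmat.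
    exact: generic_linear_eq.
  exact: generic_form_eq.
split=> [[j|j]||].
- by rewrite inE => /eqP ->; rewrite /= mcoeffZ mulVf.
- by rewrite inE; apply: var_freeP; apply: elim_var_free.
- by have := koszul_rank hm' hq' nz_m' def_e; rewrite -def_Ac /r; lia.
have -> : m * a + q * b = m' * (s *: (a + c * b)) + q' * b.
  rewrite -scalerAr scalerAl scalerA divff // scale1r.
  by rewrite [in LHS]def_q -/q'; ring.
apply/submxP; exists (row_mx (coefrow _ (s *: (a + c * b))) (coefrow _ b)).
rewrite def_Ac mul_row_col coefrowD; congr (_ + _).
  exact: coefrowM hm' e1.
exact: coefrowM hq' e2.
Qed.

(** Two variables remain, and the exponent of one of them, at most [d], determines a monomial of
    degree [d]. *)
Lemma card_two_variables d (i : 'I_3) :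
  (#|[set j : 'I_(hdim 3 d) | (mon j ord0 == 0%N) && (mon j (lift ord0 i) == 0%N)]|
     <= d.+1)%N.
Proof.
set W := [set j | _].
have [k kE] : exists k : 'I_4, forall m1 m2 : 'X_{1..4},
    m1 ord0 = 0%N -> m2 ord0 = 0%N -> m1 (lift ord0 i) = 0%N ->
    m2 (lift ord0 i) = 0%N -> mdeg m1 = mdeg m2 -> m1 k = m2 k -> m1 = m2.
  have tot (m : 'X_{1..4}) : mdeg m = (m ord0 + (m (lift ord0 ord0)
      + (m (lift ord0 (lift ord0 ord0)) + m (lift ord0 (lift ord0 (lift ord0 ord0))))))%N.
    by rewrite mdegE !big_ord_recl big_ord0 addn0.
  have ext (m1 m2 : 'X_{1..4}) : m1 ord0 = m2 ord0 ->
      m1 (lift ord0 ord0) = m2 (lift ord0 ord0) ->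
      m1 (lift ord0 (lift ord0 ord0)) = m2 (lift ord0 (lift ord0 ord0)) ->
      m1 (lift ord0 (lift ord0 (lift ord0 ord0)))
        = m2 (lift ord0 (lift ord0 (lift ord0 ord0))) -> m1 = m2.
    move=> e0 e1 e2 e3; apply/mnmP => j.
    case: (unliftP ord0 j) => [j1|] -> //; case: (unliftP ord0 j1) => [j2|] -> //.
    by case: (unliftP ord0 j2) => [j3|] -> //; rewrite [j3]ord1.
  case: (unliftP ord0 i) => [i1|] ->.
    exists (lift ord0 ord0) => m1 m2 m10 m20; rewrite !tot.
    case: (unliftP ord0 i1) => [i2|] -> m1i m2i et ek.
      have i20 : i2 = ord0 by exact: ord1.
      by rewrite i20 in m1i m2i; apply: ext; lia.
    by apply: ext; lia.
  exists (lift ord0 (lift ord0 ord0)) => m1 m2 m10 m20 m1i m2i; rewrite !tot => et ek.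
  by apply: ext; lia.
have lt_d (j : 'I_(hdim 3 d)) : (mon j k < d.+1)%N.
  by rewrite ltnS -[leqRHS](mdeg_mon j) mdegE (bigD1 k) //= leq_addr.
rewrite -[leqRHS]card_ord -(@card_in_imset _ _ (fun j => Ordinal (lt_d j)) (mem W)).
  exact: max_card.
move=> j1 j2; rewrite !inE => /andP[/eqP j10 /eqP j1i] /andP[/eqP j20 /eqP j2i] [eq_k].
by apply/mon_inj/kE; rewrite ?mdeg_mon.
Qed.

(* For the minors of the matrix with rows [m1, m2, x] and [n1, n2, -l]: the products
   of [m2 n1 - m1 n2] with [x] and [l] lie in the ideal of the other two minors. *)
Lemma minors_rescale (R : comRingType) (S T x l m1 m2 n1 n2 a b c c1 c2 c3 : R) :
  T * c = c3 + l * c2 + x * c1 ->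
  ((S * l) * (T * m1) + x * (S * T * n1)) * a + ((S * l) * m2 + x * n2) * b
    + (m2 * (S * T * n1) - (T * m1) * n2) * c
  = (l * m1 + x * n1) * (S * T * a + S * m2 * c1 - n2 * c2)
    + (l * (S * m2) + x * n2) * (b - m1 * c1 + n1 * c2)
    + ((S * m2) * n1 - m1 * n2) * c3.
Proof.
move=> Tc; have -> : (m2 * (S * T * n1) - (T * m1) * n2) * c
  = ((S * m2) * n1 - m1 * n2) * (T * c) by ring.
by rewrite Tc; ring.
Qed.

Lemma sub_rowsub_support K M (W : {set 'I_K}) (u : 'rV[F]_K) (B : 'M_(K, M)) :
  (forall j, j \notin W -> u 0 j = 0) ->
  u *m B = (\row_(t < #|W|) u 0 (enum_val t)) *m rowsub (@enum_val _ (mem W)) B.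
Proof.
move=> uW; apply/rowP => k; rewrite !mxE (bigID (mem W)) /= [X in _ + X]big1 ?addr0.
  by rewrite big_enum_val /=; apply: eq_bigr => t _; rewrite !mxE.
by move=> j /uW ->; rewrite mul0r.
Qed.

Lemma map_col_mulmat n (R S : comNzRingType) (f : {rmorphism R -> S}) d e K
    (q1 q2 p : {mpoly R[n.+1]}) (g : 'I_K -> 'I_(hdim n d)) :
  map_mx f (col_mx (col_mx (mulmat d e q1) (mulmat d e q2)) (rowsub g (mulmat d e p)))
  = col_mx (col_mx (mulmat d e (map_mpoly f q1)) (mulmat d e (map_mpoly f q2)))
      (rowsub g (mulmat d e (map_mpoly f p))).
Proof. by rewrite !map_col_mx map_mxsub !mulmat_map. Qed.

(* Scaling [l] and [m1] leaves 15 parameters, and the ideal of the three minors has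
   codimension at least [3 * e + 1] in degree [e]. *)
Lemma cubic_thin e : (5 <= e)%N ->
  thin (fun v : 'rV[F]_(hdim 3 e) => exists l m1 m2 n1 n2 a b c,
    [/\ [/\ l \is 1.-homog, m1 \is 1.-homog, m2 \is 1.-homog, n1 \is 1.-homog
          & n2 \is 1.-homog],
        [/\ var_free ord0 l, var_free ord0 m1 & var_free ord0 m2],
        l != 0, m1 != 0
      & v = coefrow e ((l * m1 + 'X_ord0 * n1) * a + (l * m2 + 'X_ord0 * n2) * b
                       + (m2 * n1 - m1 * n2) * c)]).
Proof.
move=> le5e.
have [d d_gt0 def_e] : exists2 d, (0 < d)%N & e = (2 + 2 + d)%N.
  by exists (e - 4)%N; lia.
have e' : e = (2 + (2 + d))%N by lia.
pose I : finType := ('I_5 * 'I_4)%type.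
pose L (f : 'I_5) := generic_linear F (fun j => (f, j) : I).
pose x : {mpoly {mpoly F[#|I|]}[4]} := 'X_ord0.
pose o k : 'I_5 := inord k.
pose Q1 := L (o 0%N) * L (o 1%N) + x * L (o 3%N).
pose Q2 := L (o 0%N) * L (o 2%N) + x * L (o 4%N).
pose D := L (o 2%N) * L (o 3%N) - L (o 1%N) * L (o 4%N).
(* Modulo [x] and [l] a cofactor of the third minor [D] is a form in two variables. Only these
   multiples of [D] are kept as rows, which adds at most [d.+3] to the Koszul bound in [r]. *)
pose W (i : 'I_3) := [set j : 'I_(hdim 3 (2 + d)) |
  (mon j ord0 == 0%N) && (mon j (lift ord0 i) == 0%N)].
pose A i := col_mx (col_mx (mulmat (2 + d) e Q1) (mulmat (2 + d) e Q2))
  (rowsub (@enum_val _ (mem (W i))) (mulmat (2 + d) e D)).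
pose r := (hdim 3 (2 + d) + hdim 3 (2 + d) - hdim 3 d + d.+3)%N.
(* Two coefficients are scaled to 1, and the coefficients of [x] in [l], [m1], [m2] are 0; [z] gives
   these values. *)
pose Z (i k : 'I_3) : {set I} := [set (o 0%N, lift ord0 i); (o 1%N, lift ord0 k);
  (o 0%N, ord0); (o 1%N, ord0); (o 2%N, ord0)].
pose z (u : I) : F := (u.2 != ord0)%:R.
have neq_o k1 k2 : (k1 < 5)%N -> (k2 < 5)%N -> (o k1 == o k2) = (k1 == k2).
  by move=> lt1 lt2; rewrite -val_eqE /= !inordK.
have cardZ (ik : 'I_3 * 'I_3) : (#|~: Z ik.1 ik.2| + r < hdim 3 e)%N.
  have cZ : #|Z ik.1 ik.2| = 5%N.
    by rewrite /Z -!setUA !cardsU1 cards1 !inE !xpair_eqE !neq_o.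
  rewrite cardsCs setCK cZ card_prod !card_ord.
  have := hdim3 d; have := hdim3 (2 + d); have := hdim3 e; rewrite /r def_e; lia.
apply: thin_sub (thin_exists (fun ik => thin_rowspace (A ik.1) z (cardZ ik))).
move=> v [l [m1 [m2 [n1 [n2 [a [b [c]]]]]]]].
move=> [[hl hm1 hm2 hn1 hn2] [l0 m10 m20] nz_l nz_m1 ->].
have pick_var (p : {mpoly F[4]}) : p \is 1.-homog -> var_free ord0 p -> p != 0 ->
    exists i : 'I_3, p@_U_(lift ord0 i) != 0.
  move=> hp p0 nz_p; have [u] := homog1_neq0 hp nz_p.
  case: (unliftP ord0 u) => [j|] ->; first by exists j.
  by rewrite (var_freeP p0) ?eqxx // mnm1E eqxx.
have [i nz_li] := pick_var l hl l0 nz_l; have [k nz_mk] := pick_var m1 hm1 m10 nz_m1.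
pose s := l@_U_(lift ord0 i); pose t := m1@_U_(lift ord0 k).
pose S := s%:MP_[4]; pose T := t%:MP_[4].
(* [m2] and [n1] are rescaled along with [l] and [m1], so that the three minors change only by
   constant factors. *)
pose l' := s^-1 *: l; pose m1' := t^-1 *: m1; pose m2' := s *: m2.
pose n1' := (s * t)^-1 *: n1.
have hl' : l' \is 1.-homog by rewrite rpredZ.
have hm1' : m1' \is 1.-homog by rewrite rpredZ.
have hm2' : m2' \is 1.-homog by rewrite rpredZ.
have hn1' : n1' \is 1.-homog by rewrite rpredZ.
have hx : ('X_ord0 : {mpoly F[4]}) \is 1.-homog by exact: mpolyX_homog.
have l'0 : var_free ord0 l' by rewrite /var_free comp_mpolyZ l0.
have m1'0 : var_free ord0 m1' by rewrite /var_free comp_mpolyZ m10.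
have m2'0 : var_free ord0 m2' by rewrite /var_free comp_mpolyZ m20.
pose q1 := l' * m1' + 'X_ord0 * n1'; pose q2 := l' * m2' + 'X_ord0 * n2.
pose D' := m2' * n1' - m1' * n2.
have hq1 : q1 \is 2.-homog by rewrite rpredD // (@dhomogM _ _ _ 1 _ 1).
have hq2 : q2 \is 2.-homog by rewrite rpredD // (@dhomogM _ _ _ 1 _ 1).
have hD' : D' \is 2.-homog by rewrite rpredB // (@dhomogM _ _ _ 1 _ 1).
have nz_q1 : q1 != 0.
  apply/eqP => q1_0; have := congr1 (comp_mpoly (elim ord0 'X_ord0)) q1_0.
  rewrite comp_mpoly0 rmorphD !rmorphM /= elimXX mul0r addr0 l'0 m1'0.
  move/eqP; rewrite mulf_eq0 !scaler_eq0 !invr_eq0.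
  by rewrite (negPf nz_l) (negPf nz_m1) (negPf nz_li) (negPf nz_mk).
(* Reduction modulo [x], then modulo [l'], leaves a cofactor [c3] supported on [W i]; [T] is the
   ratio of the given third minor to [D']. *)
have [c1 def_c1] := elim_mod ord0 'X_ord0 (T * c).
set c0 := (T * c) \mPo _ in def_c1.
have [c2 def_c2] := elim_mod (lift ord0 i) l' c0; set c3 := c0 \mPo _ in def_c2.
pose cc (u : I) : F := (nth 0 [:: l'; m1'; m2'; n1'; n2] u.1)@_U_(u.2).
exists (i, k); exists cc => Ac.
have LE f : map_mpoly (meval (cc \o enum_val)) (L f) = nth 0 [:: l'; m1'; m2'; n1'; n2] f.
  apply: generic_linear_eq => //.
  by case: f; do 5?[case=> //].
have xE : map_mpoly (meval (cc \o enum_val)) x = 'X_ord0 by exact: map_mpolyX.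
have Q1E : map_mpoly (meval (cc \o enum_val)) Q1 = q1.
  by rewrite [LHS]rmorphD /= [X in X + _]rmorphM [X in _ + X]rmorphM /= xE !LE /o !inordK.
have Q2E : map_mpoly (meval (cc \o enum_val)) Q2 = q2.
  by rewrite [LHS]rmorphD /= [X in X + _]rmorphM [X in _ + X]rmorphM /= xE !LE /o !inordK.
have DE : map_mpoly (meval (cc \o enum_val)) D = D'.
  by rewrite [LHS]rmorphB /= [X in X - _]rmorphM [X in _ - X]rmorphM /= !LE /o !inordK.
have def_Ac : Ac = col_mx (col_mx (mulmat (2 + d) e q1) (mulmat (2 + d) e q2))
  (rowsub (@enum_val _ (mem (W i))) (mulmat (2 + d) e D')).
  by rewrite -Q1E -Q2E -DE; exact: map_col_mulmat.
split.
- have free0 p : var_free ord0 p -> p@_U_(ord0) = 0.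
    by move=> p0; rewrite (var_freeP p0) // mnm1E eqxx.
  move=> u; rewrite /Z !inE => /orP[/orP[/orP[/orP[]|]|]|] /eqP ->;
    rewrite /cc /z /= /o inordK //= ?free0 //.
    by rewrite mcoeffZ mulVf.
  by rewrite mcoeffZ mulVf.
- rewrite def_Ac -addsmxE; apply: leq_trans (mxrank_adds_leqif _ _) _.
  apply: leq_add; last first.
    exact: leq_trans (rank_leq_row _) (card_two_variables _ _).
  by have := koszul_rank hq1 hq2 nz_q1 def_e; move: (\rank _) => k'; clear; lia.
have -> : (l * m1 + 'X_ord0 * n1) * a + (l * m2 + 'X_ord0 * n2) * b
                       + (m2 * n1 - m1 * n2) * c
  = q1 * (S * T * a + S * m2 * c1 - n2 * c2) + q2 * (b - m1' * c1 + n1' * c2) + D' * c3.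
  have lE : l = S * l' by rewrite mul_mpolyC scalerA divff // scale1r.
  have m1E : m1 = T * m1' by rewrite mul_mpolyC scalerA divff // scale1r.
  have n1E : n1 = S * T * n1'.
    by rewrite -mpolyCM mul_mpolyC scalerA divff ?scale1r // mulf_neq0.
  rewrite [in LHS]lE [in LHS]m1E [in LHS]n1E /D' /q2 /m2' -(mul_mpolyC s m2).
  by apply: minors_rescale; rewrite def_c1 {1}def_c2.
apply/submxP; exists (row_mx (row_mx (coefrow _ (S * T * a + S * m2 * c1 - n2 * c2))
  (coefrow _ (b - m1' * c1 + n1' * c2))) (\row_(u < #|W i|) coefrow _ c3 0 (enum_val u))).
rewrite def_Ac !mul_row_col [LHS]coefrowD [X in X + _ = _]coefrowD.
congr (_ + _ + _).
- exact: coefrowM hq1 e'.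
- exact: coefrowM hq2 e'.
rewrite (coefrowM _ hD' e') -sub_rowsub_support // => j.
rewrite inE negb_and mxE => /orP[]; apply: var_freeP; last first.
  by apply: elim_var_free => //; rewrite mcoeffZ mulVf ?oner_eq0.
by apply: elim_var_free_other => //; apply: elim_idem.
Qed.

End ThinFamilies.

(** * Pencils of conics *)

Section QuadraticForms.
Variable F : numClosedFieldType.

Lemma quadratic_matrix n (q : {mpoly F[n]}) : q \is 2.-homog ->
  exists2 B : 'M[F]_n, B^T = B & q = \sum_i \sum_j B i j *: ('X_i * 'X_j).
Proof.
pose is_quad p := exists2 B : 'M[F]_n, B^T = B & p = \sum_i \sum_j B i j *: ('X_i * 'X_j).
move=> /dhomogP hq; rewrite [q]mpolyE big_seq; elim/big_ind: _ => [|p1 p2 IH1 IH2|m /hq dm].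
- exists 0; first by rewrite trmx0.
  by rewrite big1 // => i _; rewrite big1 // => j _; rewrite mxE scale0r.
- have [B1 s1 ->] := IH1; have [B2 s2 ->] := IH2; exists (B1 + B2).
    by rewrite linearD /= s1 s2.
  rewrite -big_split; apply: eq_bigr => i _; rewrite -big_split; apply: eq_bigr => j _.
  by rewrite mxE scalerDl.
have [i [j ->]] : exists i j, m = (U_(i) + U_(j))%MM.
  case: (pickP (fun i => m i != 0%N)) => [i nz_mi|m0]; last first.
    by move: dm; rewrite /= mdegE big1 // => i _; have /negbFE/eqP := m0 i.
  have /submK def_m : (U_(i) <= m)%MM.
    by apply/mnm_lepP => j; rewrite mnm1E; case: eqP => // <-; rewrite lt0n.
  have /mdeg1P[j /eqP def_j] : mdeg (m - U_(i))%MM == 1%N.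
    by rewrite -(eqn_add2r (mdeg U_(i))) -mdegD def_m mdeg1 -[X in _ == X]dm.
  by exists i, j; rewrite -def_j addmC def_m.
set c := q@_ _; pose E := delta_mx i j : 'M[F]_n.
exists ((c / 2) *: (E + E^T)); first by rewrite linearZ linearD /= trmxK addrC.
have sumE (k l : 'I_n) : \sum_i0 \sum_j0 (delta_mx k l : 'M[F]_n) i0 j0 *: ('X_i0 * 'X_j0)
    = 'X_k * 'X_l :> {mpoly F[n]}.
  rewrite (bigD1 k) //= (bigD1 l) //= mxE !eqxx scale1r !big1 ?addr0 //.
    move=> k' neq_k; rewrite big1 // => l' _; rewrite mxE (negPf neq_k) scale0r //.
  by move=> l' neq_l; rewrite mxE (negPf neq_l) andbF scale0r.
transitivity ((c / 2) *: ('X_i * 'X_j + 'X_j * 'X_i : {mpoly F[n]})).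
  rewrite mpolyXD [X in _ + X]mulrC -mulr2n -scaler_nat scalerA divfK //.
  by rewrite pnatr_eq0.
rewrite -(sumE i j) -(sumE j i) -big_split scaler_sumr; apply: eq_bigr => k _.
rewrite -big_split scaler_sumr; apply: eq_bigr => l _ /=.
by rewrite -scalerDl scalerA /E trmx_delta !mxE.
Qed.

(** Either [B2] itself is singular, or an eigenvalue of [B1 *m invmx B2] gives the singular
    combination. *)
Lemma singular_pencil n (B1 B2 : 'M[F]_n.+1) : exists s t (u : 'rV[F]_n.+1),
  [/\ (s != 0) || (t != 0), u != 0 & u *m (s *: B1 + t *: B2) = 0].
Proof.
have [B2u|B2nu] := boolP (B2 \in unitmx); last first.
  have /rowV0Pn[u /sub_kermxP uB nz_u] : kermx B2 != 0 by rewrite kermx_eq0 row_free_unit.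
  by exists 0, 1, u; rewrite oner_eq0 orbT scale0r add0r scale1r.
have /closed_rootP[a] : size (char_poly (B1 *m invmx B2)) != 1%N by rewrite size_char_poly.
rewrite -eigenvalue_root_char => /eigenvalueP[u uB nz_u].
exists 1, (- a), u; rewrite oner_eq0; split=> //.
by rewrite scale1r mulmxDr scaleNr mulmxN -scalemxAr scalemxAl -uB -!mulmxA mulVmx // mulmx1 subrr.
Qed.

Lemma binary_quadratic_factor (a b c : F) : exists a1 b1 a2 b2 : F,
  [/\ a = a1 * a2, b = a1 * b2 + a2 * b1 & c = b1 * b2].
Proof.
have [->|nz_a] := eqVneq a 0; first by exists 0, 1, b, c; split; ring.
pose s := sqrtC (b ^+ 2 - 4 * a * c).
exists a, ((b - s) / 2), 1, ((b + s) / (2 * a)).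
have nz2 : (2 : F) != 0 by rewrite pnatr_eq0.
split; [by rewrite mulr1 | by field | ].
have -> : (b - s) / 2 * ((b + s) / (2 * a)) = (b ^+ 2 - s ^+ 2) / (4 * a) by field.
by rewrite sqrtCK; field.
Qed.

Lemma ord3_split (i : 'I_3) : exists j k : 'I_3,
  [/\ j != i, k != i, k != j
    & forall (V : nmodType) (f : 'I_3 -> V), \sum_l f l = f i + (f j + f k)].
Proof.
pose i1 : 'I_3 := lift ord0 ord0; pose i2 : 'I_3 := lift ord0 (lift ord0 ord0).
have sum3 (V : nmodType) (f : 'I_3 -> V) : \sum_l f l = f ord0 + (f i1 + f i2).
  by rewrite !big_ord_recl big_ord0 addr0.
case: (unliftP ord0 i) => [i'|] ->; last by exists i1, i2.
case: (unliftP ord0 i') => [i''|] ->; last first.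
  by exists ord0, i2; split=> // V f; rewrite sum3 addrCA.
have -> : i'' = ord0 by exact: ord1.
by exists ord0, i1; split=> // V f; rewrite sum3 addrA addrC.
Qed.

(* A vector in the kernel of the Gram matrix allows to eliminate a variable. *)
Lemma degenerate_conic_factor n (B : 'M[F]_3) (u : 'rV[F]_3) (y : 'I_3 -> {mpoly F[n]}) :
  B^T = B -> u != 0 -> u *m B = 0 ->
  exists c1 c2 : 'I_3 -> F, \sum_i \sum_j B i j *: (y i * y j)
    = (\sum_i c1 i *: y i) * (\sum_i c2 i *: y i).
Proof.
move=> symB nz_u uB.
have Bsym k l : B k l = B l k by rewrite -[in LHS]symB mxE.
have [i nz_ui] : exists i, u 0 i != 0.
  case: (pickP (fun i => u 0 i != 0)) => [i|u0]; first by exists i.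
  by case/eqP: nz_u; apply/rowP => i; rewrite mxE; have /negbFE/eqP := u0 i.
have [j [k [neq_ji neq_ki neq_kj sum3]]] := ord3_split i.
have uBl l : u 0 i * B i l + (u 0 j * B j l + u 0 k * B k l) = 0.
  by rewrite -(sum3 _ (fun i => u 0 i * B i l)); have /rowP/(_ l) := uB; rewrite !mxE.
pose p := u 0 j / u 0 i; pose q := u 0 k / u 0 i.
have solve l : B i l = - (p * B j l + q * B k l).
  apply/eqP; rewrite -addr_eq0 -(mulrI_eq0 _ (mulfI nz_ui)) -[X in _ == X](uBl l).
  by apply/eqP; rewrite /p /q; field.
move: p q solve => p q solve.
have [a1 [b1 [a2 [b2 [Ejj Ejk Ekk]]]]] :=
  binary_quadratic_factor (B j j) (B j k + B j k) (B k k).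
pose c (a b : F) l := if l == i then - (p * a + q * b) else if l == j then a else b.
exists (c a1 b1), (c a2 b2).
have sumc a b : \sum_l c a b l *: y l
    = - (p%:MP * a%:MP + q%:MP * b%:MP) * y i + (a%:MP * y j + b%:MP * y k).
  rewrite sum3 /c eqxx (negPf neq_ji) (negPf neq_ki) (negPf neq_kj) eqxx.
  by rewrite -!mpolyCM -mpolyCD -mpolyCN !mul_mpolyC.
rewrite !sumc sum3 !sum3 (solve i) (Bsym j i) (Bsym k i) (solve j) (solve k) (Bsym k j).
rewrite -!mul_mpolyC !(mpolyCM, mpolyCD, mpolyCN).
have Ejk' : (B j k)%:MP_[n] + (B j k)%:MP = a1%:MP * b2%:MP + a2%:MP * b1%:MP.
  by rewrite -!mpolyCM -!mpolyCD Ejk.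
rewrite Ejj Ekk !mpolyCM; move: (B j k)%:MP Ejk' => X eqX.
(* The kernel vector makes the ternary form a binary one in [z1] and [z2], and binary forms split
   over [F]. *)
pose z1 := y j - p%:MP * y i; pose z2 := y k - q%:MP * y i.
transitivity (a1%:MP * a2%:MP * z1 ^+ 2 + (X + X) * (z1 * z2) + b1%:MP * b2%:MP * z2 ^+ 2).
  by rewrite /z1 /z2; ring.
by rewrite eqX /z1 /z2; ring.
Qed.

(** The conics cut on the plane [x = 0] form a pencil; a singular member of it splits into two
    lines, and [n] collects the terms divisible by [x]. *)
Lemma degenerate_member (q1 q2 : {mpoly F[4]}) : q1 \is 2.-homog -> q2 \is 2.-homog ->
  exists s t l m n, [/\ (s != 0) || (t != 0), l \is 1.-homog, m \is 1.-homog,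
    var_free ord0 l /\ var_free ord0 m
    & s *: q1 + t *: q2 = l * m + 'X_ord0 * n].
Proof.
move=> h1 h2.
pose y (i : 'I_3) : {mpoly F[4]} := 'X_(lift ord0 i).
have hyp q : q \is 2.-homog -> exists B : 'M[F]_3, exists n,
    B^T = B /\ q = \sum_i \sum_j B i j *: (y i * y j) + 'X_ord0 * n.
  move=> /quadratic_matrix[C symC defq].
  have [n def_n] := elim_mod ord0 'X_ord0 q.
  exists (\matrix_(i, j) C (lift ord0 i) (lift ord0 j)), n; split.
    by apply/matrixP => i j; rewrite !mxE -{1}symC mxE.
  rewrite def_n; congr (_ + _); rewrite [in LHS]defq rmorph_sum big_ord_recl /= rmorph_sum.
  rewrite big1 ?add0r => [|j _]; last by rewrite /= comp_mpolyZ rmorphM /= elimXX mul0r scaler0.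
  apply: eq_bigr => i _; rewrite rmorph_sum big_ord_recl /=.
  rewrite comp_mpolyZ rmorphM /= elimXX mulr0 scaler0 add0r; apply: eq_bigr => j _.
  by rewrite comp_mpolyZ rmorphM /= !var_freeX // mxE.
have [B1 [n1 [s1 ->]]] := hyp _ h1; have [B2 [n2 [s2 ->]]] := hyp _ h2.
have [s [t [u [nz_st nz_u uB]]]] := singular_pencil B1 B2.
have symB : (s *: B1 + t *: B2)^T = s *: B1 + t *: B2.
  by rewrite linearD !linearZ /= s1 s2.
have [c1 [c2 def_c]] := degenerate_conic_factor y symB nz_u uB.
have hom (c : 'I_3 -> F) : \sum_i c i *: y i \is 1.-homog.
  by apply: rpred_sum => i _; rewrite rpredZ // mpolyX_homog.
have free (c : 'I_3 -> F) : var_free ord0 (\sum_i c i *: y i).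
  rewrite /var_free rmorph_sum /=; apply: eq_bigr => i _.
  by rewrite comp_mpolyZ var_freeX.
exists s, t, (\sum_i c1 i *: y i), (\sum_i c2 i *: y i), (s *: n1 + t *: n2).
split=> //; rewrite -def_c mulrDr -!scalerAr !scalerDr addrACA; congr (_ + _).
rewrite !scaler_sumr -big_split; apply: eq_bigr => i _.
rewrite !scaler_sumr -big_split; apply: eq_bigr => j _ /=.
by rewrite !scalerA -scalerDl !mxE.
Qed.

End QuadraticForms.

(** * Residual of a plane *)

Section Residual.
Variable F : numClosedFieldType.
Implicit Types (a b c g l m n p q r u v w : {mpoly F[4]}).
Local Notation x := ('X_ord0 : {mpoly F[4]}).

(** Take for [c'] the degree [d] component of [c]. *)
Lemma homog_cofactor s d l c : l \is s.-homog -> l * c \is (s + d).-homog ->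
  exists2 c', c' \is d.-homog & l * c = l * c'.
Proof.
move=> hl hlc; exists (form_of (coefrow d c)); first exact: form_of_homog.
apply: (coefrow_inj hlc); first by rewrite dhomogM // form_of_homog.
by rewrite !(coefrowM _ hl erefl) coefrow_form.
Qed.

Lemma meval_homog0 k d (p : {mpoly F[k]}) : p \is d.-homog -> (0 < d)%N ->
  p.@[fun=> 0] = 0.
Proof.
move=> /dhomogP hp d_gt0; rewrite mevalE big_seq big1 // => m /hp /= dm.
case: (pickP (fun i => m i != 0%N)) => [i nz_mi|m0].
  by rewrite (bigD1 i) //= expr0n (negPf nz_mi) mul0r mulr0.
by move: d_gt0; rewrite -dm mdegE big1 // => i _; have /negbFE/eqP := m0 i.
Qed.

(** All syzygies are Koszul. This follows from [regular_seq] and, in this form, passes easily to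
    other generators of the pencil. *)
Definition koszul_exact p r := forall u v, p * u + r * v = 0 ->
  exists w, u = r * w /\ v = - (p * w).

Lemma koszul_exact_sym p r : koszul_exact p r -> koszul_exact r p.
Proof.
move=> K u v; rewrite addrC => /K[w [-> ->]].
by exists (- w); rewrite !mulrN opprK.
Qed.

Lemma koszul_exact_sub p r k : koszul_exact p r -> koszul_exact p (r - p * k).
Proof.
move=> K u v eq0; have [|w [def_u def_v]] := K (u - k * v) v.
  by rewrite -eq0; ring.
by exists w; split=> //; rewrite -[LHS](subrK (k * v)) def_u def_v; ring.
Qed.

Lemma koszul_exact_comb (s t : F) p r : s != 0 ->
  koszul_exact p r -> koszul_exact (s *: p + t *: r) r.
Proof.
rewrite -!mul_mpolyC => nz_s K u v eq0.
have [|w [su tu]] := K (s%:MP * u) (t%:MP * u + v); first by rewrite -eq0; ring.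
have ss : s^-1%:MP * s%:MP = 1 :> {mpoly F[4]} by rewrite -mpolyCM mulVf.
have def_u : u = r * (s^-1%:MP * w) by rewrite mulrCA -su mulrA ss mul1r.
exists (s^-1%:MP * w); split=> //.
have -> : v = - (p * ((s^-1%:MP * s%:MP) * w)) - t%:MP * u.
  by rewrite ss mul1r -tu; ring.
by rewrite {}def_u; ring.
Qed.

(* The possible residuals of the plane [x = 0] in a surface [x * g = 0] containing
   [q1 = q2 = 0]: the pencil may cut on the plane conics without common component,
   a fixed conic, or conics sharing a line. *)
Definition quartic_residual g := exists q1 q2 a b,
  [/\ q1 \is 2.-homog, q2 \is 2.-homog, q1 != 0 & g = q1 * a + q2 * b].

Definition conic_residual g := exists m q a b,
  [/\ m \is 1.-homog, q \is 2.-homog, m != 0 & g = m * a + q * b].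

Definition cubic_residual g := exists l m1 m2 n1 n2 a b c,
  [/\ [/\ l \is 1.-homog, m1 \is 1.-homog, m2 \is 1.-homog, n1 \is 1.-homog
        & n2 \is 1.-homog],
      [/\ var_free ord0 l, var_free ord0 m1 & var_free ord0 m2],
      l != 0, m1 != 0
    & g = (l * m1 + x * n1) * a + (l * m2 + x * n2) * b + (m2 * n1 - m1 * n2) * c].

Lemma x_neq0 : x != 0.
Proof. by apply/eqP => /(congr1 (mcoeff U_(ord0))); rewrite mcoeffXU mcoeff0; apply/eqP/oner_neq0. Qed.

Lemma x_inj u v : x * u = x * v -> u = v.
Proof. exact: (mulfI x_neq0). Qed.

Lemma koszul_exact_neq p r c : p \is 2.-homog -> koszul_exact p r -> r <> p * c.
Proof.
move=> hp K def_r; have [|w [_ /(congr1 (meval (fun=> 0)))]] := K (- c) 1.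
  by rewrite def_r; ring.
rewrite meval1 mevalN mevalM (meval_homog0 hp) // mul0r oppr0 => /eqP.
by rewrite oner_eq0.
Qed.

(** With a common factor [x], the syzygy [(n', - n)] would be a multiple of [(r, - p)], making [x] a
    unit. *)
Lemma koszul_exact_x p r n n' : p \is 2.-homog -> koszul_exact p r -> p = x * n -> r <> x * n'.
Proof.
move=> hp K def_p def_r; have [|w [def_n' _]] := K n' (- n).
  by rewrite def_r def_p; ring.
have nz_n' : n' != 0.
  apply/eqP => n'0; apply: (koszul_exact_neq (c := 0) hp K).
  by rewrite def_r n'0 !mulr0.
have : n' * 1 = n' * (x * w) by rewrite {1}def_n' def_r; ring.
move=> /(mulfI nz_n')/(congr1 (meval (fun=> 0)))/eqP.
by rewrite meval1 mevalM mevalXU mul0r oner_eq0.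
Qed.

Lemma mod_x p : exists c, p = p \mPo elim ord0 x + x * c.
Proof. exact: elim_mod. Qed.

Lemma mod_x_eq0 p : p \mPo elim ord0 x = 0 -> exists c, p = x * c.
Proof. by have [c ->] := mod_x p => p0; exists c; move: p0; rewrite rmorphD rmorphM /= elimXX mul0r addr0 elim_idem => ->; rewrite add0r. Qed.

(** [p] is nonzero modulo the prime [x], so [x] divides [a]; dividing the equation by [x] puts [g]
    in the ideal of [p] and the linear form [n']. *)
Lemma residual_conic p r n g a b : p \is 2.-homog -> r \is 2.-homog ->
  koszul_exact p r -> r = x * n -> x * g = p * a + r * b -> conic_residual g.
Proof.
move=> hp hr K def_r eq_g.
have [||n' hn' def_n'] := @homog_cofactor 1 1 x n; rewrite -?def_r ?mpolyX_homog //.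
rewrite -def_r in def_n'.
have nz_px : p \mPo elim ord0 x != 0.
  by apply/eqP => /mod_x_eq0[c def_p]; apply: (koszul_exact_x hp K def_p def_n').
have [a' def_a] : exists a', a = x * a'.
  apply: mod_x_eq0; apply/eqP; rewrite -(mulrI_eq0 _ (mulfI nz_px)) -rmorphM /=.
  have -> : p * a = x * (g - n' * b) by rewrite mulrBr eq_g def_n'; ring.
  by rewrite rmorphM /= elimXX mul0r.
exists n', p, b, a'; split=> //; last first.
  by apply: x_inj; rewrite eq_g def_n' def_a; ring.
apply/eqP => n'0; apply: (koszul_exact_neq (c := 0) hp K).
by rewrite def_n' n'0 !mulr0.
Qed.

(* Reduction modulo the ideal of the line [x = l = 0]. *)
Definition red i l p := (p \mPo elim ord0 x) \mPo elim i l.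

Lemma redD i l p q : red i l (p + q) = red i l p + red i l q.
Proof. by rewrite /red !rmorphD. Qed.

Lemma redM i l p q : red i l (p * q) = red i l p * red i l q.
Proof. by rewrite /red !rmorphM. Qed.

Lemma red_x i l : red i l x = 0.
Proof. by rewrite /red elimXX comp_mpoly0. Qed.

Lemma red_l i l : l \is 1.-homog -> l@_U_(i) != 0 -> var_free ord0 l -> red i l l = 0.
Proof. by move=> hl nz_li fl; rewrite /red [l \mPo _]fl elim_self. Qed.

Lemma red_eq0 i l p : red i l p = 0 ->
  exists c1 c2, p = x * c1 + l * c2 /\ p \mPo elim ord0 x = l * c2.
Proof.
rewrite /red => red0; have [c1 def_p] := mod_x p.
have [c2] := elim_mod i l (p \mPo elim ord0 x); rewrite red0 add0r => def_px.
by exists c1, c2; split; rewrite // [LHS]def_p def_px addrC.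
Qed.

Lemma free_x_inj l c u : var_free ord0 l -> l != 0 -> l * c = x * u -> exists w, c = x * w.
Proof.
move=> fl nz_l /(congr1 (comp_mpoly (elim ord0 x)))/eqP.
rewrite !rmorphM /= elimXX mul0r [l \mPo _]fl mulf_eq0 (negPf nz_l) /= => /eqP.
exact: mod_x_eq0.
Qed.

(** When [r] vanishes on neither line, [x] can be cancelled modulo [p] and [r]: reducing modulo each
    line in turn shows that [b] is [p * u] plus a multiple of [x], and then [x] divides
    [a + r * u]. *)
Lemma residual_quartic p r l m n i j g a b : p \is 2.-homog -> r \is 2.-homog ->
  l \is 1.-homog -> m \is 1.-homog -> var_free ord0 l -> var_free ord0 m ->
  l@_U_(i) != 0 -> m@_U_(j) != 0 -> p != 0 -> p = l * m + x * n ->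
  red i l r != 0 -> red j m r != 0 -> x * g = p * a + r * b -> quartic_residual g.
Proof.
move=> hp hr hl hm fl fm nz_li nz_mj nz_p def_p nz_lr nz_mr eq_g.
have nz (q : {mpoly F[4]}) k : q@_U_(k) != 0 -> q != 0.
  by apply: contra_neq => ->; rewrite mcoeff0.
have /red_eq0[b2 [b1 [def_b _]]] : red i l b = 0.
  apply/eqP; rewrite -(mulrI_eq0 _ (mulfI nz_lr)) -redM.
  have -> : r * b = x * (g - n * a) + l * (- m * a).
    by rewrite mulrBr eq_g def_p; ring.
  by rewrite redD !redM red_x red_l // !mul0r addr0.
have [c def_c] : exists c, m * a + r * b1 = x * c.
  apply: (@free_x_inj l _ (g - n * a - r * b2)) => //; first exact: nz nz_li.
  by rewrite !mulrBr eq_g def_b def_p; ring.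
have /red_eq0[w [u [def_b1 _]]] : red j m b1 = 0.
  apply/eqP; rewrite -(mulrI_eq0 _ (mulfI nz_mr)) -redM.
  have -> : r * b1 = x * c + m * (- a) by rewrite -def_c; ring.
  by rewrite redD !redM red_x red_l // !mul0r addr0.
have [z def_z] : exists z, a + r * u = x * z.
  apply: (@free_x_inj m _ (c - r * w)) => //; first exact: nz nz_mj.
  by rewrite mulrBr -def_c def_b1; ring.
exists p, r, z, (l * w + b2 - n * u); split=> //; apply: x_inj.
have -> : x * g = p * (x * z - r * u) + r * b by rewrite eq_g -def_z; ring.
by rewrite def_b def_b1 def_p; ring.
Qed.

(** Here [r = l * m2' + x * n2']. If [m] divides [m2'] modulo [x], some [r - p * k'] is divisible by
    [x]. Otherwise the extra generator comes from [x * (m2' * n' - m * n2') = m2' * p - m * r]. *)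
Lemma residual_cubic p r l m n i j g a b : p \is 2.-homog -> r \is 2.-homog ->
  koszul_exact p r ->
  l \is 1.-homog -> m \is 1.-homog -> var_free ord0 l -> var_free ord0 m ->
  l@_U_(i) != 0 -> m@_U_(j) != 0 -> p = l * m + x * n ->
  red i l r = 0 -> x * g = p * a + r * b -> conic_residual g \/ cubic_residual g.
Proof.
move=> hp hr K hl hm fl fm nz_li nz_mj def_p lr0 eq_g.
have nz (q : {mpoly F[4]}) k : q@_U_(k) != 0 -> q != 0.
  by apply: contra_neq => ->; rewrite mcoeff0.
have hx : x \is 1.-homog by exact: mpolyX_homog.
have homM2 (u v : {mpoly F[4]}) : u \is 1.-homog -> v \is 1.-homog -> u * v \is 2.-homog.
  exact: (@dhomogM _ _ _ 1 _ 1).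
have [n' hn' def_n'] : exists2 n', n' \is 1.-homog & x * n = x * n'.
  apply: (@homog_cofactor 1 1) => //.
  have -> : x * n = p - l * m by rewrite def_p addrC addKr.
  by rewrite rpredB // homM2.
have [n2 [m2 [def_r def_rx]]] := red_eq0 lr0.
have fhr : r \mPo elim ord0 x \is 2.-homog by exact: elim_homog.
have [m2' hm2' def_m2] : exists2 m2', m2' \is 1.-homog & l * m2 = l * m2'.
  by apply: (@homog_cofactor 1 1); rewrite // -def_rx.
have [n2' hn2' def_n2] : exists2 n2', n2' \is 1.-homog & x * n2 = x * n2'.
  apply: (@homog_cofactor 1 1) => //.
  have -> : x * n2 = r - l * m2' by rewrite def_r def_m2 addrK.
  by rewrite rpredB // homM2.
rewrite {}def_n2 {}def_m2 {}def_n' in def_p def_r def_rx.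
have fm2 : var_free ord0 m2'.
  apply: (mulfI (nz _ _ nz_li)); rewrite -[in LHS]fl -rmorphM /= -def_rx.
  exact: elim_idem.
have [mm2|nz_mm2] := eqVneq (red j m m2') 0; [left | right].
  have [_ [k [_ def_m2]]] := red_eq0 mm2.
  have def_m2k : m2' = m * k by rewrite -[LHS]fm2.
  have [|k' hk' def_k] := @homog_cofactor 1 0 m k hm; first by rewrite -def_m2k.
  rewrite {}def_k in def_m2k.
  apply: (@residual_conic p (r - p * k') (n2' - n' * k') g (a + k' * b) b) => //.
  - by rewrite rpredB // (@dhomogM _ _ _ 2 _ 0).
  - exact: koszul_exact_sub.
  - by rewrite def_r def_p def_m2k; ring.
  by rewrite eq_g; ring.
have [c def_c] : exists c, m * a + m2' * b = x * c.
  apply: (@free_x_inj l _ (g - n' * a - n2' * b)) => //; first exact: nz nz_li.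
  by rewrite !mulrBr eq_g def_r def_p; ring.
have /red_eq0[w [c3 [def_b _]]] : red j m b = 0.
  apply/eqP; rewrite -(mulrI_eq0 _ (mulfI nz_mm2)) -redM.
  have -> : m2' * b = x * c + m * (- a) by rewrite -def_c; ring.
  by rewrite redD !redM red_x red_l // !mul0r addr0.
have [z def_z] : exists z, a + m2' * c3 = x * z.
  apply: (@free_x_inj m _ (c - m2' * w)) => //; first exact: nz nz_mj.
  by rewrite mulrBr -def_c def_b; ring.
exists l, m, m2', n', n2', z, w, (- c3); split; [by split | by split | exact: nz nz_li | exact: nz nz_mj |].
apply: x_inj.
have -> : x * g = p * (x * z - m2' * c3) + r * b by rewrite eq_g -def_z; ring.
by rewrite def_b def_r def_p; ring.
Qed.

Lemma residual_pencil p r l m n g a b : p \is 2.-homog -> r \is 2.-homog ->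
  koszul_exact p r ->
  l \is 1.-homog -> m \is 1.-homog -> var_free ord0 l -> var_free ord0 m ->
  p = l * m + x * n -> x * g = p * a + r * b ->
  [\/ quartic_residual g, conic_residual g | cubic_residual g].
Proof.
move=> hp hr K hl hm fl fm def_p eq_g.
have conic_p : p = x * n -> [\/ quartic_residual g, conic_residual g | cubic_residual g].
  move=> def_px; apply: Or32.
  apply: (residual_conic hr hp (koszul_exact_sym K) def_px (a := b) (b := a)).
  by rewrite eq_g addrC.
have [l0|nz_l] := eqVneq l 0; first by apply: conic_p; rewrite def_p l0 mul0r add0r.
have [m0|nz_m] := eqVneq m 0; first by apply: conic_p; rewrite def_p m0 mulr0 add0r.
have [i nz_li] := homog1_neq0 hl nz_l; have [j nz_mj] := homog1_neq0 hm nz_m.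
have nz_p : p != 0.
  apply/eqP => p0; apply: (koszul_exact_neq (c := 0) hr (koszul_exact_sym K)).
  by rewrite p0 mulr0.
have [lr0|nz_lr] := eqVneq (red i l r) 0.
  have [] := residual_cubic hp hr K hl hm fl fm nz_li nz_mj def_p lr0 eq_g.
    by constructor 2.
  by constructor 3.
have [mr0|nz_mr] := eqVneq (red j m r) 0.
  have def_p' : p = m * l + x * n by rewrite mulrC.
  have [] := residual_cubic hp hr K hm hl fm fl nz_mj nz_li def_p' mr0 eq_g.
    by constructor 2.
  by constructor 3.
constructor 1.
exact: (residual_quartic hp hr hl hm fl fm nz_li nz_mj nz_p def_p nz_lr nz_mr eq_g).
Qed.

End Residual.

(** * Zeros on a line *)

Section LinearFactors.
Variable F : numClosedFieldType.
Local Notation x := ('X_ord0 : {mpoly F[4]}).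
Local Notation i1 := (lift ord0 ord0 : 'I_4).
Local Notation i2 := (lift ord0 (lift ord0 ord0) : 'I_4).
Local Notation i3 := (lift ord0 (lift ord0 (lift ord0 ord0)) : 'I_4).
Local Notation y := ('X_i1 : {mpoly F[4]}).
Implicit Types (g l b c p : {mpoly F[4]}).

Definition point4 (R : nzRingType) (a b c d : R) (i : 'I_4) : R :=
  nth 0 [:: a; b; c; d] i.

Lemma prod_ord4 (R : comNzRingType) (f : 'I_4 -> R) :
  \prod_i f i = f ord0 * (f i1 * (f i2 * f i3)).
Proof. by rewrite !big_ord_recl big_ord0 mulr1. Qed.

(** [h] dehomogenises the restriction of [g] to the line [x = y = 0]. If [h] is a nonzero constant,
    its coefficient of degree [e] is 0, and [g] vanishes at the point at infinity. *)
Lemma line_zero g e : g \is e.-homog -> (0 < e)%N ->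
  exists2 v, v = point4 0 0 1 0 \/ (exists r, v = point4 0 0 r 1) & g.@[v] = 0.
Proof.
move=> /dhomogP hg e_gt0; pose h := mmap polyC (point4 0 0 'X 1) g.
have h_eval r : h.[r] = g.@[point4 0 0 r 1].
  rewrite /h /mmap mevalE horner_sum; apply: eq_bigr => m _.
  rewrite hornerM hornerC /mmap1 !prod_ord4 /point4 /= !hornerM !horner_exp.
  by rewrite !hornerE.
have [/closed_rootP[r /rootP hr]|/negPn/eqP sz] := boolP (size h != 1%N).
  by exists (point4 0 0 r 1); [right; exists r | rewrite -h_eval].
exists (point4 0 0 1 0); first by left.
suff -> : g.@[point4 0 0 1 0] = h`_e by rewrite nth_default // sz.
rewrite /h /mmap mevalE coef_sum big_seq [RHS]big_seq; apply: eq_bigr => m /hg /= dm.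
rewrite coefCM /mmap1 !prod_ord4 /point4 /=; congr (_ * _).
rewrite !expr0n !expr1n mulr1 mul1r -dm mdegE !big_ord_recl big_ord0 addn0.
case: eqP => [->|_]; last by rewrite !mulr0n !mul0r coef0.
case: eqP => [->|_]; last by rewrite !mulr0n !mul0r !mulr0 coef0.
by rewrite !mul1r !add0n coefXn -{2}[m i2]addn0 eqn_add2l.
Qed.

Lemma elim_meval i l p v : l.@[v] = 0 -> (p \mPo elim i l).@[v] = p.@[v].
Proof.
move=> lv; rewrite comp_mpoly_meval; apply: meval_eq => j.
rewrite tnth_mktuple mevalB mevalXU; case: eqP => _; rewrite ?meval0 ?subr0 //.
by rewrite mevalZ lv mulr0 subr0.
Qed.

Lemma one_variable_eq0 e p k v : p \is e.-homog ->
  (forall j, j != k -> var_free j p) -> v k = 1 -> p.@[v] = 0 -> p = 0.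
Proof.
move=> hp free vk pv.
have coef0 m : m != (U_(k) *+ e)%MM -> p@_m = 0.
  move=> neq_m; have [dm|/eqP dm] := mdeg m =P e; last first.
    by rewrite (dhomog_nemf_coeff hp).
  case: (pickP (fun j => (j != k) && (m j != 0%N))) => [j /andP[neq_jk]|m0].
    by apply: var_freeP; apply: free.
  case/eqP: neq_m; have m0' j : j != k -> m j = 0%N.
    by move=> neq_jk; have := m0 j; rewrite neq_jk /= => /negbFE/eqP.
  apply/mnmP => j; rewrite mulmnE mnm1E; have [<-|neq] := eqVneq k j.
    by rewrite mul1n -dm mdegE (bigD1 k) //= big1 ?addn0.
  by rewrite m0' // eq_sym.
have def_p : p = p@_(U_(k) *+ e) *: 'X_[U_(k) *+ e].
  apply/mpolyP => m; rewrite mcoeffZ mcoeffX; case: eqP => [<-|/eqP neq_m].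
    by rewrite mulr1.
  by rewrite mulr0 coef0 // eq_sym.
move: pv; rewrite def_p mevalZ mevalX (bigD1 k) //= vk expr1n mul1r big1 ?mulr1.
  by move=> ->; rewrite scale0r.
by move=> j neq_jk; rewrite mulmnE mnm1E eq_sym (negPf neq_jk) mul0n expr0.
Qed.

Lemma ord4_cases (j : 'I_4) : [\/ j = ord0, j = i1, j = i2 | j = i3].
Proof.
by case: j => [[|[|[|[|?]]]]] // ?; [constructor 1 | constructor 2 | constructor 3
  | constructor 4]; apply/val_inj.
Qed.

Lemma linear_factor g e : g \is e.-homog -> (0 < e)%N -> exists l c,
  [/\ l \is 1.-homog, l != 0, var_free ord0 l, var_free i1 l
    & red i1 y g = l * c].
Proof.
move=> hg e_gt0; have [v def_v gv] := line_zero hg e_gt0.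
have [i [k [a [vk def_a [v0 v1] [neq_ik i0 ii1 k0 ki1] others]]]] : exists i k a,
    [/\ v k = 1, v i = a, v ord0 = 0 /\ v i1 = 0,
      [/\ i != k, i != ord0, i != i1, k != ord0 & k != i1]
      & forall j, j != i -> j != k -> j = ord0 \/ j = i1].
  have others j : j != i2 -> j != i3 -> j = ord0 \/ j = i1.
    by case: (ord4_cases j) => -> //; [left | right].
  case: def_v => [->|[r ->]]; first by exists i3, i2, 0; split=> // j ? ?; apply: others.
  by exists i2, i3, r; split=> // j ? ?; apply: others.
(* [l] vanishes at [v]. Modulo [l] the restricted form involves only ['X_k], and it vanishes at a
   point where ['X_k] is 1, so it is zero. *)
pose l : {mpoly F[4]} := 'X_i - a *: 'X_k.
have hl : l \is 1.-homog by rewrite rpredB ?rpredZ ?mpolyX_homog.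
have free_l j : j != i -> j != k -> var_free j l.
  move=> ji jk; rewrite /var_free rmorphB /= comp_mpolyZ !var_freeX //.
  by rewrite eq_sym.
  by rewrite eq_sym.
have li : l@_U_(i) = 1.
  by rewrite mcoeffB mcoeffZ !mcoeffXU eqxx eq_sym (negPf neq_ik) mulr0 subr0.
have nz_li : l@_U_(i) != 0 by rewrite li oner_eq0.
exists l.
have [|c def_c] := (elim_dvd (red i1 y g) hl nz_li).2; last first.
  exists c; split=> //; try by apply: free_l; rewrite eq_sym.
  by apply: contraNneq nz_li => ->; rewrite mcoeff0.
have hy : y \is 1.-homog by exact: mpolyX_homog.
have hx : x \is 1.-homog by exact: mpolyX_homog.
have f1 : var_free i1 (red i1 y g) by exact: elim_idem.
have f0 : var_free ord0 (red i1 y g).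
  by apply: elim_var_free_other; [exact: var_freeX | | exact: elim_idem].
have hr : red i1 y g \is e.-homog by exact: elim_homog hy (elim_homog _ hx hg).
apply: (one_variable_eq0 (elim_homog i hl hr) _ vk).
  move=> j neq_jk; have [->|neq_ji] := eqVneq j i; first exact: elim_var_free.
  apply: (elim_var_free_other (free_l _ neq_ji neq_jk) neq_ji).
  by case: (others j neq_ji neq_jk) => ->.
rewrite elim_meval; last first.
  by rewrite mevalB mevalZ !mevalXU vk def_a mulr1 subrr.
by rewrite /red !elim_meval ?mevalXU.
Qed.

(* [b] is a pair of planes through two of the zeros of [g] on the line [x = y = 0]. *)
Lemma quadric_through_line_points g e : g \is e.+2.-homog -> exists A B b C,
  [/\ A \is e.+1.-homog, B \is e.+1.-homog, C \is e.-homog, b \is 2.-homog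
    & [/\ b != 0, var_free ord0 b & g = x * A + y * B + b * C]].
Proof.
move=> hg; have hx : x \is 1.-homog by exact: mpolyX_homog.
have hy : y \is 1.-homog by exact: mpolyX_homog.
have [l1 [c [hl1 nz_l1 f0l1 f1l1 def_g]]] := linear_factor hg isT.
have [|c1 hc1 def_c] := @homog_cofactor F 1 e.+1 l1 c hl1.
  by rewrite -def_g; apply: elim_homog => //; apply: elim_homog.
have [l2 [C [hl2 nz_l2 f0l2 f1l2 def_c1]]] := linear_factor hc1 isT.
have def_red : red i1 y g = l1 * l2 * C.
  have red_idem : red i1 y (red i1 y g) = red i1 y g.
    have f0 : var_free ord0 (red i1 y g).
      by apply: elim_var_free_other; [exact: var_freeX | | exact: elim_idem].
    by rewrite {1}/red [X in X \mPo _]f0; apply: elim_idem.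
  rewrite -red_idem def_g def_c redM def_c1 mulrA; congr (_ * _ * _).
  by rewrite /red [X in X \mPo _]f0l1.
have [A def_A] := elim_mod ord0 x g.
have [B def_B] := elim_mod i1 y (g \mPo elim ord0 x).
pose b := l1 * l2; have hb : b \is 2.-homog by exact: (@dhomogM _ _ _ 1 _ 1).
have eq_g : g = x * A + y * B + b * C.
  by rewrite {1}def_A {1}def_B -/(red i1 y g) def_red /b; ring.
exists (form_of (coefrow e.+1 A)), (form_of (coefrow e.+1 B)), b, (form_of (coefrow e C)).
split; rewrite ?form_of_homog //; split; first by rewrite mulf_neq0.
  by rewrite /var_free rmorphM /= f0l1 f0l2.
apply: (coefrow_inj hg).
  rewrite rpredD ?rpredD //.
  - by apply: (@dhomogM _ _ _ 1 _ e.+1); rewrite ?form_of_homog.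
  - by apply: (@dhomogM _ _ _ 1 _ e.+1); rewrite ?form_of_homog.
  by apply: (@dhomogM _ _ _ 2 _ e); rewrite ?form_of_homog.
rewrite {1}eq_g !coefrowD !(coefrowM _ hx (erefl : e.+2 = (1 + e.+1)%N)).
rewrite !(coefrowM _ hy (erefl : e.+2 = (1 + e.+1)%N)).
by rewrite !(coefrowM _ hb (erefl : e.+2 = (2 + e)%N)) !coefrow_form.
Qed.

End LinearFactors.

(** * Regular sequences and limits *)

Section Closure.
Local Notation x := ('X_ord0 : {mpoly CC[4]}).
Local Notation i1 := (lift ord0 ord0 : 'I_4).
Local Notation y := ('X_i1 : {mpoly CC[4]}).
Implicit Types (a b c g p q u : {mpoly CC[4]}).

Lemma in_ideal0 u : in_ideal [::] u <-> u = 0.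
Proof.
split=> [[cs [_ ->]]|->]; first by rewrite big_ord0.
by exists [::]; rewrite big_ord0.
Qed.

Lemma in_ideal1 p u : in_ideal [:: p] u <-> exists c, u = p * c.
Proof.
split=> [[[|c [|? ?]] [//= _ ->]]|[c ->]].
  by exists c; rewrite big_ord_recl big_ord0 addr0 mulrC.
by exists [:: c]; rewrite /= big_ord_recl big_ord0 addr0 mulrC.
Qed.

Lemma in_ideal2 p q u : in_ideal [:: p; q] u <-> exists a b, u = p * a + q * b.
Proof.
split=> [[[|a [|b [|? ?]]] [//= _ ->]]|[a [b ->]]].
  by exists a, b; rewrite !big_ord_recl big_ord0 addr0 /= ![_ * a]mulrC ![_ * b]mulrC.
by exists [:: a; b]; rewrite /= !big_ord_recl big_ord0 addr0 /= ![_ * a]mulrC ![_ * b]mulrC.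
Qed.

Lemma regular_seq2 p q s t : p \is s.+1.-homog -> q \is t.+1.-homog -> p != 0 ->
  (forall u c, q * u = p * c -> exists c', u = p * c') -> regular_seq [:: p; q].
Proof.
move=> hp hq nz_p pq; split.
  move=> [|[|//]] _ u /=.
    by rewrite !in_ideal0 => /eqP; rewrite mulf_eq0 (negPf nz_p) => /eqP.
  by rewrite !in_ideal1 => -[c /pq].
rewrite in_ideal2 => -[a [b /(congr1 (meval (fun=> 0)))/eqP]].
rewrite meval1 mevalD !mevalM (meval_homog0 hp) // (meval_homog0 hq) //.
by rewrite !mul0r addr0 oner_eq0.
Qed.

Lemma regular_seq_koszul p q : regular_seq [:: p; q] -> koszul_exact p q.
Proof.
move=> [reg not1] u v eq0.
have nz_p : p != 0.
  apply/eqP => p0; apply: not1; apply/in_ideal2; exists 0, 0.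
  have /in_ideal0 : in_ideal [::] (1 : {mpoly CC[4]}).
    by apply: (reg 0%N isT 1); apply/in_ideal0; rewrite /= p0 mul0r.
  by move->; rewrite !mulr0 addr0.
have /in_ideal1[w def_v] : in_ideal [:: p] v.
  apply: (reg 1%N isT v); apply/in_ideal1; exists (- u) => /=.
  by apply/eqP; rewrite -subr_eq0 mulrN opprK addrC eq0.
exists (- w); split; last by rewrite mulrN opprK.
apply: (mulfI nz_p); apply/eqP; rewrite -subr_eq0 -[X in _ == X]eq0 def_v.
by apply/eqP; ring.
Qed.

(* [f = x * g + q * 0] for any [q] prime to [x]. *)
Lemma product_inF e s g q : g \is e.-homog -> g != 0 -> (s < e.+1)%N ->
  q \is s.+1.-homog -> q \mPo elim ord0 x != 0 -> inF 3 e.+1 [:: 1%N; s.+1] (x * g).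
Proof.
move=> hg nz_g lt_se hq nz_q; have hx : x \is 1.-homog by exact: mpolyX_homog.
split; first by split; [rewrite mulf_neq0 ?x_neq0 | apply: (@dhomogM _ _ _ 1 _ e)].
exists [:: x; q], [:: g; 0]; split=> //.
- by case=> [|[|//]] _ /=; split=> //; rewrite ?subn1 ?dhomog0.
- by rewrite !big_ord_recl big_ord0 /= mulr0 !addr0.
apply: (regular_seq2 (s := 0) hx hq) => [|u c eq_qu]; first exact: x_neq0.
apply: mod_x_eq0; apply/eqP; rewrite -(mulrI_eq0 _ (mulfI nz_q)) -rmorphM /= eq_qu.
by rewrite rmorphM /= elimXX mul0r.
Qed.

(* Since [x (x y + t b) - y x^2 = t x b], the form [f + t b B] belongs to the ideal
   of [x^2] and [x y + t b] for every nonzero [t]. *)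
Lemma product_closure e g : g \is e.+2.-homog -> g != 0 ->
  zariski_closure 3 e.+3 (inF 3 e.+3 [:: 2; 2]%N) (x * g).
Proof.
move=> hg nz_g; have hx : x \is 1.-homog by exact: mpolyX_homog.
have hy : y \is 1.-homog by exact: mpolyX_homog.
have hxg : x * g \is e.+3.-homog by exact: (@dhomogM _ _ _ 1 _ e.+2).
have nz_xg : x * g != 0 by rewrite mulf_neq0 ?x_neq0.
split; first by [].
move=> N ms P vanP.
have [A [B [b [C [hA hB hC hb [nz_b fb def_g]]]]]] := quadric_through_line_points hg.
have hx2 : x * x \is 2.-homog by exact: (@dhomogM _ _ _ 1 _ 1).
have hbB : b * B \is e.+3.-homog by exact: (@dhomogM _ _ _ 2 _ e.+1).
have in_F t : t != 0 -> x * g + t *: (b * B) != 0 ->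
    inF 3 e.+3 [:: 2; 2]%N (x * g + t *: (b * B)).
  move=> nz_t nz_f; split; first by split; rewrite // rpredD // rpredZ.
  have hq : x * y + t *: b \is 2.-homog.
    by rewrite rpredD ?rpredZ // (@dhomogM _ _ _ 1 _ 1).
  exists [:: x * x; x * y + t *: b], [:: A - t^-1 *: (y * C); B + t^-1 *: (x * C)].
  split=> //.
  - case=> [|[|//]] _ /=; split=> //; rewrite ?rpredB ?rpredD ?rpredZ //.
      exact: (@dhomogM _ _ _ 1 _ e).
    exact: (@dhomogM _ _ _ 1 _ e).
  - rewrite !big_ord_recl big_ord0 addr0 /= def_g -!mul_mpolyC.
    have tt : t%:MP * t^-1%:MP = 1 :> {mpoly CC[4]} by rewrite -mpolyCM divff.
    have -> : x * (x * A + y * B + b * C)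
      = x * x * A + x * y * B + (t%:MP * t^-1%:MP) * (x * b * C) by rewrite tt; ring.
    by ring.
  apply: (regular_seq2 hx2 hq) => [|u c eq_u]; first by rewrite mulf_neq0 ?x_neq0.
  (* Modulo [x] the second quadric is [t *: b], which is nonzero as [b] is free of [x]. Hence [x]
     can be extracted, and twice for [x * x]. *)
  have div_x v w : (x * y + t *: b) * v = x * w -> exists w', v = x * w'.
    move=> eq_v; apply: mod_x_eq0; apply/eqP.
    have nz_tb : t *: b != 0 by rewrite scaler_eq0 negb_or nz_t.
    rewrite -(mulrI_eq0 _ (mulfI nz_tb)).
    have -> : (t *: b) * (v \mPo elim ord0 x) = ((x * y + t *: b) * v) \mPo elim ord0 x.
      rewrite [RHS]rmorphM /= rmorphD /= comp_mpolyZ [b \mPo _]fb.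
      by rewrite [(x * y) \mPo _]rmorphM /= elimXX mul0r add0r.
    by rewrite eq_v rmorphM /= elimXX mul0r.
  have [u' def_u] := div_x u (x * c) (etrans eq_u (esym (mulrA _ _ _))).
  have [|u'' def_u'] := div_x u' c; last by exists u''; rewrite def_u def_u' mulrA.
  by apply: x_inj; rewrite mulrCA -def_u eq_u mulrA.
have [m nz_m] : exists m, (x * g)@_m != 0.
  case: (msupp (x * g) =P [::]) => [/msuppnil0/eqP|]; first by rewrite (negPf nz_xg).
  case def_s: (msupp _) => [//|m s] _; exists m.
  by rewrite -mcoeff_msupp def_s inE eqxx.
pose coef (k : 'X_{1..4}) : {poly CC} := ((x * g)@_k)%:P + ((b * B)@_k)%:P * 'X.
have coefE k t : (coef k).[t] = (x * g + t *: (b * B))@_k.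
  by rewrite hornerD hornerM !hornerC hornerX mcoeffD mcoeffZ [t * _]mulrC.
pose U := mmap polyC (fun i => coef (tnth ms i)) P.
have UE t : U.[t] = P.@[fun i => (x * g + t *: (b * B))@_(tnth ms i)].
  rewrite /U /mmap mevalE horner_sum; apply: eq_bigr => k _.
  rewrite hornerM hornerC horner_prod; congr (_ * _); apply: eq_bigr => i _.
  by rewrite horner_exp coefE.
(* Membership in [F(2, 2)] is known only for nonzero [t] and a nonzero form; the factors ['X] and
   [coef m] kill the exceptions, and are themselves nonzero polynomials. *)
have prod0 : U * coef m * 'X = 0.
  apply: poly_eq0_horner => t; rewrite !hornerM hornerX.
  have [->|nz_t] := eqVneq t 0; first by rewrite mulr0.
  have [ct0|nz_ct] := eqVneq (coef m).[t] 0; first by rewrite ct0 mulr0 mul0r.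
  rewrite UE vanP ?mul0r //; apply: in_F => //.
  by apply: contraNneq nz_ct => f0; rewrite coefE f0 mcoeff0.
have U0 : U = 0.
  have nz_c : coef m != 0.
    by apply: contraNneq nz_m => c0; have := coefE m 0; rewrite c0 horner0 scale0r addr0 => <-.
  move/eqP: prod0; rewrite !mulf_eq0 (negPf nz_c) polyX_eq0 !orbF.
  by move/eqP.
by have := UE 0; rewrite U0 horner0 scale0r addr0 => <-.
Qed.

Lemma residual_of_inF d g : inF 3 d [:: 2; 2]%N (x * g) ->
  [\/ quartic_residual g, conic_residual g | cubic_residual g].
Proof.
move=> [_ [fs [gs [sz_f sz_g hfg eq_g reg]]]].
case: fs sz_f hfg eq_g reg => [|p [|r [|? ?]]] //= _.
case: gs sz_g => [|a [|b [|? ?]]] //= _ hfg.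
rewrite !big_ord_recl big_ord0 addr0 /= => eq_g /regular_seq_koszul K.
have [/= hp _] := hfg 0%N isT; have [/= hr _] := hfg 1%N isT.
(* A member of the pencil cuts a singular conic on the plane [x = 0]. *)
have [s [t [l [m [n [nz_st hl hm [fl fm] def_p]]]]]] := degenerate_member hp hr.
(* The singular member replaces [p] if [s] is nonzero; otherwise it is a multiple of [r], and the
   two generators are exchanged. *)
have [s0|nz_s] := eqVneq s 0.
  rewrite s0 scale0r add0r eqxx /= in def_p nz_st.
  have K' : koszul_exact (t *: r) p.
    by have := koszul_exact_comb (t := 0) nz_st (koszul_exact_sym K); rewrite scale0r addr0.
  apply: (residual_pencil _ hp K' hl hm fl fm def_p (a := t^-1 *: b) (b := a)).
    by rewrite rpredZ.
  by rewrite eq_g -scalerAr -scalerAl scalerA mulVf // scale1r addrC.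
apply: (residual_pencil _ hr (koszul_exact_comb (t := t) nz_s K) hl hm fl fm def_p
  (a := s^-1 *: a) (b := b - (s^-1 * t) *: a)).
  by rewrite rpredD ?rpredZ.
have ss : s%:MP * s^-1%:MP = 1 :> {mpoly CC[4]} by rewrite -mpolyCM divff.
rewrite eq_g -!mul_mpolyC mpolyCM.
have -> : p * a = (s%:MP * s^-1%:MP) * (p * a) by rewrite ss mul1r.
by ring.
Qed.

End Closure.

Theorem theorem6p8 (d : nat) : (6 <= d)%N ->
  exists f : S 3,
    [/\ zariski_closure 3 d (inF 3 d [:: 2; 2]%N) f,
        ~ inF 3 d [:: 2; 2]%N f,
        inF 3 d [:: 1; 3]%N f
      & inF 3 d [:: 1; 1]%N f].
Proof.
case: d => [|[|[|e]]] // le6d; have le5e : (5 <= e.+2)%N by [].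
have [v notv] := thin_proper (thinU (quartic_thin CC le5e)
  (thinU (conic_thin CC le5e) (cubic_thin CC le5e))).
pose g := form_of v; have hg : g \is e.+2.-homog by exact: form_of_homog.
have def_v : v = coefrow e.+2 g by rewrite coefrow_form.
have not_res : ~ [\/ quartic_residual g, conic_residual g | cubic_residual g].
  case=> res; apply: notv; rewrite def_v.
  - by left; have [q1 [q2 [a [b [h1 h2 nz ->]]]]] := res; exists q1, q2, a, b.
  - by right; left; have [m [q [a [b [h1 h2 nz ->]]]]] := res; exists m, q, a, b.
  right; right; have [l [m1 [m2 [n1 [n2 [a [b [c [h1 h2 nz1 nz2 ->]]]]]]]]] := res.
  by exists l, m1, m2, n1, n2, a, b, c.
have nz_g : g != 0.
  (* The zero form is a conic residual, with all cofactors zero. *)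
  apply/eqP => g0; apply: not_res; constructor 2; exists 'X_ord0, 0, 0, 0.
  by rewrite g0 !mulr0 addr0 dhomog0 mpolyX_homog x_neq0.
pose y : {mpoly CC[4]} := 'X_(lift ord0 ord0).
have hy : y \is 1.-homog by exact: mpolyX_homog.
have nz_y k : (y ^+ k) \mPo elim ord0 'X_ord0 != 0.
  rewrite rmorphXn /= var_freeX // expf_neq0 //.
  by apply/eqP => /(congr1 (mcoeff U_(lift ord0 ord0)))/eqP;
    rewrite mcoeffXU mcoeff0 eqxx oner_eq0.
exists ('X_ord0 * g); split.
- exact: product_closure.
- by move/residual_of_inF.
- apply: (product_inF (s := 2) hg nz_g) (nz_y 3%N); first by lia.
  by have := dhomogMn 3 hy.
apply: (product_inF (s := 0) hg nz_g) (nz_y 1%N); first by lia.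
by rewrite expr1.
Qed.
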